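(* Let $X$ be a curve of genus $\geq 2$, $G\subset\mathrm{Aut}(X)$ a finite group, $\pi:X\to Y=X/G$ the corresponding Galois cover, and $M\subset N\subset G$ subgroups. Let $\psi:X_M\to X_N$ be the associated cover, where $X_M=X/M$ and $X_N=X/N$. Let $$JX\sim JY\times B_2^{n_2}\times\cdots\times B_r^{n_r}$$ be the isogeny decomposition of $JX$ with respect to $G$, where $B_i$ is attached to the nontrivial irreducible $\mathbb{Q}$-representation $W_i$ of $G$. Then there exist non-negative integers $s_i$, $i=2,\dots,r$, such that $$P(X_M/X_N)\sim B_2^{s_2}\times\cdots\times B_r^{s_r}.$$
   Context: Curves are smooth, irreducible, projective over $\mathbb{C}$. $\sim$ means ''isogenous to''. Prym variety: for a (finite) morphism $f:X\to Y$ of curves, $P(X/Y):=\ker(\mathrm{Nm} f:JX\to JY)^{\circ}$, the connected component of $0$ of the kernel of the norm map (equivalently the complement of $f^*JY$ in $JX$ with respect to the canonical polarization). Isogeny decomposition: $G$ acts on $JX$, giving $\rho:\mathbb{Q}[G]\to\mathrm{End}_{\mathbb{Q}}(JX)$. For $\alpha\in\mathbb{Q}[G]$ put $\mathrm{Im}(\alpha):=\mathrm{Im}(\rho(m\alpha))$ for any positive integer $m$ with $m\alpha\in\mathbb{Z}[G]$. Let $W_1$ (trivial), $W_2,\dots,W_r$ be the irreducible $\mathbb{Q}$-representations of $G$, $D_i=\mathrm{End}_G(W_i)$, $n_i=\dim_{D_i}W_i$, and let $Q_i\simeq\mathrm{End}_{D_i}(W_i)$ be the corresponding simple factor of $\mathbb{Q}[G]$.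 Choosing a $D_i$-basis of $W_i$ identifies $Q_i$ with the matrix ring $M(n_i\times n_i,D_i)$; let $p_{i,1}\in Q_i\subset\mathbb{Q}[G]$ be the primitive idempotent corresponding to the matrix with entry $1$ at place $(1,1)$ and $0$ elsewhere. Then $B_i:=\mathrm{Im}(p_{i,1})\subset JX$, whose isogeny class does not depend on the choices. *)

(* Defs.v *)
From HB Require Import structures.
From mathcomp Require Import all_boot all_order all_algebra all_fingroup.
From mathcomp Require Import all_character.
From mathcomp Require Import mpoly.
From mathcomp Require Import reals complex.

Set Implicit Arguments.
Unset Strict Implicit.
Unset Printing Implicit Defensive.

Import GRing.Theory.
Local Open Scope ring_scope.

Section Homogeneous.
Variable K : closedFieldType.

Definition nonzero n (v : 'I_n -> K) : Prop := exists i, v i != 0.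

Definition proportional n (u v : 'I_n -> K) : Prop :=
  exists2 c : K, c != 0 & forall i, u i = c * v i.

(* Homogeneous coordinates of the image of a pair of points under the Segre
   embedding. *)
Definition segre n m (u : 'I_n -> K) (v : 'I_m -> K) : 'I_(n * m) -> K :=
  fun k => mxvec (\matrix_(i < n, j < m) (u i * v j)) 0 k.

(* The points of P^(m-1) with coordinates b t are, locally on T, given by
   homogeneous polynomials of a common degree in the homogeneous coordinates
   a t. *)
Definition locally_polynomial (T : Type) n m
    (a : T -> 'I_n -> K) (b : T -> 'I_m -> K) : Prop :=
  forall t, exists (d : nat) (F : 'I_m -> {mpoly K[n]}),
    [/\ forall j, F j \is d.-homog,
        nonzero (fun j => (F j).@[a t])
      & forall t', nonzero (fun j => (F j).@[a t']) ->
          proportional (b t') (fun j => (F j).@[a t'])].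

Lemma segreE n m (u : 'I_n -> K) (v : 'I_m -> K) i j :
  segre u v (mxvec_index i j) = u i * v j.
Proof. by rewrite /segre mxvecE mxE. Qed.

Lemma nonzero_segre n m (u : 'I_n -> K) (v : 'I_m -> K) :
  nonzero u -> nonzero v -> nonzero (segre u v).
Proof.
by move=> [i ui] [j vj]; exists (mxvec_index i j); rewrite segreE mulf_neq0.
Qed.

Lemma segre_nonzero n m (u : 'I_n -> K) (v : 'I_m -> K) :
  nonzero (segre u v) -> nonzero u /\ nonzero v.
Proof.
case=> k; case/mxvec_indexP: k => i j; rewrite segreE mulf_eq0 negb_or.
by case/andP=> ui vj; split; [exists i | exists j].
Qed.

Lemma proportional_sym n (u v : 'I_n -> K) :
  proportional u v -> proportional v u.
Proof.
case=> c c0 uv; exists c^-1; first by rewrite invr_eq0.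
by move=> i; rewrite uv mulKf.
Qed.

Lemma proportional_trans n (u v w : 'I_n -> K) :
  proportional u v -> proportional v w -> proportional u w.
Proof.
case=> c c0 uv [d d0 vw]; exists (c * d); first by rewrite mulf_neq0.
by move=> i; rewrite uv vw mulrA.
Qed.

Lemma proportional_nonzero n (u v : 'I_n -> K) :
  proportional u v -> nonzero v -> nonzero u.
Proof. by case=> c c0 uv [i vi]; exists i; rewrite uv mulf_neq0. Qed.

Lemma proportional_segre n m (u u' : 'I_n -> K) (v v' : 'I_m -> K) :
  proportional u u' -> proportional v v' ->
  proportional (segre u v) (segre u' v').
Proof.
case=> c c0 uu [d d0 vv]; exists (c * d); first by rewrite mulf_neq0.
by move=> k; case/mxvec_indexP: k => i j; rewrite !segreE uu vv mulrACA.
Qed.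

Lemma segre_inj n m (u u' : 'I_n -> K) (v v' : 'I_m -> K) :
  nonzero u -> nonzero v -> nonzero u' -> nonzero v' ->
  proportional (segre u v) (segre u' v') ->
  proportional u u' /\ proportional v v'.
Proof.
move=> [i ui] [j vj] _ _ [c c0 E].
have E' k l : u k * v l = c * (u' k * v' l) by rewrite -!segreE E.
have : u i * v j != 0 by rewrite mulf_neq0.
rewrite E' !mulf_eq0 !negb_or => /and3P[_ u'i v'j].
split.
- exists (c * v' j / v j); first by rewrite !mulf_neq0 ?invr_eq0.
  move=> k; apply: (mulIf vj); rewrite E'.
  by rewrite [RHS]mulrAC mulfVK // -mulrA [v' j * _]mulrC.
- exists (c * u' i / u i); first by rewrite !mulf_neq0 ?invr_eq0.
  move=> k; apply: (mulfI ui); rewrite E'.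
  by rewrite [RHS]mulrA [u i * _]mulrC mulfVK // mulrA.
Qed.

Lemma homog_scale n d (p : {mpoly K[n]}) (c : K) (u v : 'I_n -> K) :
  p \is d.-homog -> (forall i, u i = c * v i) -> p.@[u] = c ^+ d * p.@[v].
Proof.
move=> /dhomogP hp uv; rewrite !mevalE mulr_sumr big_seq [RHS]big_seq.
apply: eq_bigr => m /hp dm; rewrite mulrCA; congr (_ * _).
under eq_bigr => i _ do rewrite uv exprMn.
by rewrite big_split /= prodrXr -mdegE dm.
Qed.

Lemma homog_proportional n d (p : {mpoly K[n]}) (u v : 'I_n -> K) :
  p \is d.-homog -> proportional u v -> p.@[u] = 0 <-> p.@[v] = 0.
Proof.
move=> hp [c c0 uv]; rewrite (homog_scale hp uv); split=> [/eqP|->].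
  by rewrite mulf_eq0 expf_eq0 (negPf c0) andbF => /eqP.
by rewrite mulr0.
Qed.

Lemma homogU n (i : 'I_n) : ('X_i : {mpoly K[n]}) \is 1.-homog.
Proof. by rewrite dhomogX; apply/eqP; exact: mdeg1. Qed.

Definition subst n m (p : {mpoly K[n]}) (F : 'I_n -> {mpoly K[m]}) :=
  p \mPo [tuple F i | i < n].

Lemma meval_subst n m (p : {mpoly K[n]}) (F : 'I_n -> {mpoly K[m]}) v :
  (subst p F).@[v] = p.@[fun i => (F i).@[v]].
Proof.
rewrite /subst comp_mpoly_meval; apply: meval_eq => i.
by rewrite !tnth_map tnth_ord_tuple.
Qed.

Lemma homog_subst n m d e (p : {mpoly K[n]}) (F : 'I_n -> {mpoly K[m]}) :
  p \is d.-homog -> (forall i, F i \is e.-homog) ->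
  subst p F \is (e * d).-homog.
Proof.
move=> /dhomogP hp hF; rewrite /subst comp_mpolyE big_seq.
apply: rpred_sum => mu /hp dmu; apply: rpredZ.
have <- : (\sum_i mu i)%N = d by rewrite -mdegE dmu.
rewrite big_distrr /=.
elim/big_ind2: _ => [|x1 x2 y1 y2 h1 h2|i _]; first exact: dhomog1.
  exact: dhomogM.
by rewrite !tnth_map tnth_ord_tuple; exact: dhomogMn.
Qed.

End Homogeneous.

Section Varieties.
Variable K : closedFieldType.

(* A (possibly reducible) Zariski closed subset of P^(hdim - 1), the set of
   its points being identified with T: hcoord x is a vector of homogeneous
   coordinates of x. *)
Record projective_structure (T : Type) := ProjectiveStructure {
  hdim : nat;
  hcoord : T -> 'I_hdim -> K;
  hcoord_nonzero : forall x, nonzero (hcoord x);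
  hcoord_inj : forall x y, proportional (hcoord x) (hcoord y) -> x = y;
  hcoord_closed : exists S : {mpoly K[hdim]} -> Prop,
    (forall p, S p -> exists d, p \is d.-homog) /\
    forall v, nonzero v ->
      ((forall p, S p -> p.@[v] = 0) <->
       exists x, proportional v (hcoord x))
}.

Record variety := Variety {
  points :> choiceType;
  pstr : projective_structure points
}.

Definition hc (X : variety) : X -> 'I_(hdim (pstr X)) -> K := @hcoord _ (pstr X).

Definition vanishes_on (X : variety) (p : {mpoly K[hdim (pstr X)]}) : Prop :=
  forall x : X, p.@[hc x] = 0.

Definition zclosed (X : variety) (Z : X -> Prop) : Prop :=
  exists S : {mpoly K[hdim (pstr X)]} -> Prop,
    (forall p, S p -> exists d, p \is d.-homog) /\
    forall x, Z x <-> forall p, S p -> p.@[hc x] = 0.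

Definition zirreducible (X : variety) (Z : X -> Prop) : Prop :=
  (exists x, Z x) /\
  forall Z1 Z2 : X -> Prop, zclosed Z1 -> zclosed Z2 ->
    (forall x, Z x -> Z1 x \/ Z2 x) ->
    (forall x, Z x -> Z1 x) \/ (forall x, Z x -> Z2 x).

Definition zconnected (X : variety) (Z : X -> Prop) : Prop :=
  forall Z1 Z2 : X -> Prop, zclosed Z1 -> zclosed Z2 ->
    (forall x, Z x -> Z1 x \/ Z2 x) ->
    (forall x, Z x -> Z1 x -> Z2 x -> False) ->
    (forall x, Z x -> Z1 x) \/ (forall x, Z x -> Z2 x).

Definition connected_component (X : variety) (Z : X -> Prop) (x : X)
    : X -> Prop :=
  fun y => exists C : X -> Prop,
    [/\ zconnected C, forall z, C z -> Z z, C x & C y].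

Definition irreducible_variety (X : variety) : Prop :=
  zirreducible (fun _ : X => True).

Definition has_irreducible_chain (X : variety) (d : nat) : Prop :=
  exists Z : nat -> X -> Prop,
    (forall k, (k <= d)%N -> zclosed (Z k) /\ zirreducible (Z k)) /\
    (forall k, (k < d)%N ->
       (forall x, Z k x -> Z k.+1 x) /\ exists x, Z k.+1 x /\ ~ Z k x).

Definition has_dimension (X : variety) (d : nat) : Prop :=
  has_irreducible_chain X d /\ ~ has_irreducible_chain X d.+1.

(* Jacobian criterion for a variety of pure dimension d: the tangent space at
   x of the affine cone over X has dimension d + 1. *)
Definition smooth_of_dimension (X : variety) (d : nat) : Prop :=
  forall x : X, exists T : 'M[K]_(d.+1, hdim (pstr X)),
    row_free T /\
    forall v : 'rV[K]_(hdim (pstr X)),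
      (v <= T)%MS <->
      forall (p : {mpoly K[hdim (pstr X)]}) e, p \is e.-homog ->
        vanishes_on p -> \sum_i (p^`M(i)).@[hc x] * v 0 i = 0.

Definition is_curve (X : variety) : Prop :=
  [/\ irreducible_variety X, has_dimension X 1 & smooth_of_dimension X 1].

(* The degree k part of the homogeneous coordinate ring has dimension r. *)
Definition hilbert_function (X : variety) (k r : nat) : Prop :=
  exists b : 'I_r -> {mpoly K[hdim (pstr X)]},
    (forall i, b i \is k.-homog) /\
    forall p : {mpoly K[hdim (pstr X)]}, p \is k.-homog ->
      exists! c : {ffun 'I_r -> K}, vanishes_on (p - \sum_i c i *: b i).

(* The Hilbert polynomial of a curve of genus g has constant term 1 - g. *)
Definition has_genus (X : variety) (g : nat) : Prop :=
  exists d k0 : nat, forall k : nat, (k0 <= k)%N ->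
    exists2 r, hilbert_function X k r & (r + g = d * k + 1)%N.

Definition regular (X Y : variety) (f : X -> Y) : Prop :=
  locally_polynomial (@hc X) (fun x => hc (f x)).

(* A regular map that is an isomorphism onto its image. *)
Definition closed_immersion (X Y : variety) (f : X -> Y) : Prop :=
  [/\ regular f, injective f & locally_polynomial (fun x => hc (f x)) (@hc X)].

Lemma regular_comp (X Y Z : variety) (f : X -> Y) (g : Y -> Z) :
  regular f -> regular g -> regular (g \o f).
Proof.
move=> rf rg x; have [d [F [hF [i Fi] Fp]]] := rf x.
have [e [G [hG Gy Gp]]] := rg (f x).
have GE x' c j : (forall i, hc (f x') i = c * (F i).@[hc x']) ->
    (G j).@[hc (f x')] = c ^+ e * (subst (G j) F).@[hc x'].
  by move=> E; rewrite meval_subst; apply: homog_scale.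
exists (d + d * e)%N, (fun j => F i * subst (G j) F); split.
- by move=> j; apply: dhomogM => //; apply: homog_subst.
- have [c c0 E] := Fp x (ex_intro _ i Fi).
  have [j] := Gy; rewrite (GE _ _ _ E) mulf_eq0 negb_or => /andP[_ Gj].
  by exists j; rewrite mevalM mulf_neq0.
- move=> x'; case=> j; rewrite mevalM mulf_eq0 negb_or => /andP[Fi' Gj'].
  have [c c0 E] := Fp x' (ex_intro _ i Fi').
  have [|b b0 E'] := Gp (f x').
    by exists j; rewrite (GE _ _ _ E) mulf_neq0 // expf_eq0 (negPf c0) andbF.
  exists (b * c ^+ e / (F i).@[hc x']).
    by rewrite !mulf_neq0 ?invr_eq0 // expf_eq0 (negPf c0) andbF.
  by move=> k; rewrite E' (GE _ _ _ E) mevalM -!mulrA mulKf.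
Qed.

Section Product.
Variables X Y : variety.

Let hcP (z : X * Y) := segre (hc z.1) (hc z.2).

Lemma hc_nonzero (Z : variety) (x : Z) : nonzero (hc x).
Proof. exact: hcoord_nonzero. Qed.

Lemma vanish_hc (Z : variety) (S : {mpoly K[hdim (pstr Z)]} -> Prop)
    (homS : forall p, S p -> exists d, p \is d.-homog)
    (HS : forall v, nonzero v -> ((forall p, S p -> p.@[v] = 0) <->
            exists x : Z, proportional v (hc x))) p (z : Z) :
  S p -> p.@[hc z] = 0.
Proof.
move=> Sp; have [_ H] := HS _ (hc_nonzero z).
by apply: H => //; exists z, 1; rewrite ?oner_neq0 // => i; rewrite mul1r.
Qed.

Lemma prod_nonzero z : nonzero (hcP z).
Proof. by apply: nonzero_segre; exact: hc_nonzero. Qed.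

Lemma prod_inj z z' : proportional (hcP z) (hcP z') -> z = z'.
Proof.
case: z z' => [x y] [x' y'] /segre_inj[]; try exact: hc_nonzero.
move=> xx yy; congr (_, _); first exact: (@hcoord_inj _ (pstr X)).
exact: (@hcoord_inj _ (pstr Y)).
Qed.

Lemma prod_closed :
  exists S : {mpoly K[hdim (pstr X) * hdim (pstr Y)]} -> Prop,
    (forall p, S p -> exists d, p \is d.-homog) /\
    forall v, nonzero v ->
      ((forall p, S p -> p.@[v] = 0) <-> exists z, proportional v (hcP z)).
Proof.
exists (fun p => (exists d, p \is d.-homog) /\ forall z, p.@[hcP z] = 0).
split=> [p []//|v v_nz]; split; last first.
  by case=> z vz p [[d hp] p0]; apply/(homog_proportional hp vz).
move=> Sv; have [k] := v_nz; case/mxvec_indexP: k => a b vab.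
pose W i j := v (mxvec_index i j).
have minor i j : W i j * W a b = W i b * W a j.
  pose p : {mpoly K[hdim (pstr X) * hdim (pstr Y)]} :=
    'X_(mxvec_index i j) * 'X_(mxvec_index a b)
      - 'X_(mxvec_index i b) * 'X_(mxvec_index a j).
  have /Sv : (exists d, p \is d.-homog) /\ forall z, p.@[hcP z] = 0.
    split; first by exists (1 + 1)%N; apply: rpredB; apply: dhomogM; exact: homogU.
    move=> z; rewrite mevalB !mevalM !mevalXU /hcP !segreE.
    by apply/eqP; rewrite subr_eq0 mulrACA [X in _ * X]mulrC mulrACA.
  by rewrite mevalB !mevalM !mevalXU => /eqP; rewrite subr_eq0 => /eqP.
pose u i := W i b; pose w j := W a j.
have [x ux] : exists x : X, proportional u (hc x).
  have [S [homS HS]] := hcoord_closed (pstr X).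
  apply/(HS u); first by exists a.
  move=> p Sp; have [d hp] := homS p Sp.
  pose q := subst p (fun i => 'X_(mxvec_index i b)).
  have /Sv : (exists d', q \is d'.-homog) /\ forall z, q.@[hcP z] = 0.
    split.
      by exists (1 * d)%N; apply: homog_subst => // i; exact: homogU.
    move=> z; rewrite meval_subst.
    rewrite (@homog_scale _ _ d _ (hc z.2 b) _ (hc z.1)) //; last first.
      by move=> i; rewrite mevalXU /hcP segreE mulrC.
    by rewrite (vanish_hc homS HS) // mulr0.
  rewrite meval_subst => pu; rewrite -{}pu.
  by apply: meval_eq => i; rewrite mevalXU.
have [y wy] : exists y : Y, proportional w (hc y).
  have [S [homS HS]] := hcoord_closed (pstr Y).
  apply/(HS w); first by exists b.
  move=> p Sp; have [d hp] := homS p Sp.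
  pose q := subst p (fun j => 'X_(mxvec_index a j)).
  have /Sv : (exists d', q \is d'.-homog) /\ forall z, q.@[hcP z] = 0.
    split.
      by exists (1 * d)%N; apply: homog_subst => // i; exact: homogU.
    move=> z; rewrite meval_subst.
    rewrite (@homog_scale _ _ d _ (hc z.1 a) _ (hc z.2)) //; last first.
      by move=> i; rewrite mevalXU /hcP segreE.
    by rewrite (vanish_hc homS HS) // mulr0.
  rewrite meval_subst => pw; rewrite -{}pw.
  by apply: meval_eq => i; rewrite mevalXU.
exists (x, y); apply: (@proportional_trans _ _ _ (segre u w)); last first.
  exact: proportional_segre.
exists (W a b)^-1; first by rewrite invr_eq0.
move=> k; case/mxvec_indexP: k => i j; rewrite segreE -minor.
by rewrite mulrCA -/(W i j) mulVf ?mulr1.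
Qed.

Definition prod_structure : projective_structure (X * Y)%type :=
  ProjectiveStructure prod_nonzero prod_inj prod_closed.

Definition prodv : variety := Variety prod_structure.

Let linl (y : Y) k : {mpoly K[hdim (pstr X)]} :=
  mxvec (\matrix_(i, j) (hc y j *: 'X_i)) 0 k.
Let linr (x : X) k : {mpoly K[hdim (pstr Y)]} :=
  mxvec (\matrix_(i, j) (hc x i *: 'X_j)) 0 k.

Let linl_homog y k : linl y k \is 1.-homog.
Proof.
case/mxvec_indexP: k => i j; rewrite /linl mxvecE mxE.
by apply: rpredZ; exact: homogU.
Qed.

Let linr_homog x k : linr x k \is 1.-homog.
Proof.
case/mxvec_indexP: k => i j; rewrite /linr mxvecE mxE.
by apply: rpredZ; exact: homogU.
Qed.

Let meval_linl p x y : (subst p (linl y)).@[hc x] = p.@[hcP (x, y)].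
Proof.
rewrite meval_subst; apply: meval_eq => k; case/mxvec_indexP: k => i j.
by rewrite /hcP segreE /linl mxvecE mxE mevalZ mevalXU mulrC.
Qed.

Let meval_linr p x y : (subst p (linr x)).@[hc y] = p.@[hcP (x, y)].
Proof.
rewrite meval_subst; apply: meval_eq => k; case/mxvec_indexP: k => i j.
by rewrite /hcP segreE /linr mxvecE mxE mevalZ mevalXU.
Qed.

Lemma zclosed_slices (Z : prodv -> Prop) :
  zclosed Z -> @zclosed X (fun x => forall y, Z (x, y)).
Proof.
case=> S [homS HS].
exists (fun q => exists p y, S p /\ q = subst p (linl y)); split.
  move=> _ [p [y [/homS[d hp] ->]]]; exists (1 * d)%N.
  exact: homog_subst.
move=> x; split=> [Zx _ [p [y [Sp ->]]]|H y].
  by rewrite meval_linl; exact: (proj1 (HS (x, y)) (Zx _)).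
apply/HS => p Sp; rewrite -[hc _]/(hcP (x, y)) -meval_linl.
by apply: H; exists p, y.
Qed.

Lemma zclosed_slice (Z : prodv -> Prop) x :
  zclosed Z -> @zclosed Y (fun y => Z (x, y)).
Proof.
case=> S [homS HS].
exists (fun q => exists p, S p /\ q = subst p (linr x)); split.
  move=> _ [p [/homS[d hp] ->]]; exists (1 * d)%N.
  exact: homog_subst.
move=> y; split=> [Zx _ [p [Sp ->]]|H].
  by rewrite meval_linr; exact: (proj1 (HS (x, y)) Zx).
apply/HS => p Sp; rewrite -[hc _]/(hcP (x, y)) -meval_linr.
by apply: H; exists p.
Qed.

Lemma prod_irreducible :
  irreducible_variety X -> irreducible_variety Y -> irreducible_variety prodv.
Proof.
move=> [[x0 _] irX] [[y0 _] irY]; split; first by exists (x0, y0).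
move=> Z1 Z2 c1 c2 cov.
have [||x _|H|H] := irX (fun x => forall y, Z1 (x, y)) (fun x => forall y, Z2 (x, y)).
- exact: zclosed_slices.
- exact: zclosed_slices.
- have [||y _|H|H] := irY (fun y => Z1 (x, y)) (fun y => Z2 (x, y)).
  + exact: zclosed_slice.
  + exact: zclosed_slice.
  + exact: cov.
  + by left; move=> y; apply: H.
  + by right; move=> y; apply: H.
- by left; case=> x y _; apply: H.
- by right; case=> x y _; apply: H.
Qed.

Lemma regular_fst : @regular prodv X fst.
Proof.
move=> [x y]; have [j yj] := hc_nonzero y.
exists 1%N, (fun i => 'X_(mxvec_index i j)); split.
- by move=> i; exact: homogU.
- have [i xi] := hc_nonzero x; exists i.
  by rewrite mevalXU /hc /= /hcP segreE mulf_neq0.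
- case=> x' y'; case=> i; rewrite mevalXU /hc /= /hcP segreE /=.
  rewrite mulf_eq0 negb_or => /andP[_ yj'].
  apply: proportional_sym; exists (hc y' j) => // k.
  by rewrite mevalXU segreE mulrC.
Qed.

Lemma regular_snd : @regular prodv Y snd.
Proof.
move=> [x y]; have [i xi] := hc_nonzero x.
exists 1%N, (fun j => 'X_(mxvec_index i j)); split.
- by move=> j; exact: homogU.
- have [j yj] := hc_nonzero y; exists j.
  by rewrite mevalXU /hc /= /hcP segreE mulf_neq0.
- case=> x' y'; case=> j; rewrite mevalXU /hc /= /hcP segreE /=.
  rewrite mulf_eq0 negb_or => /andP[xi' _].
  apply: proportional_sym; exists (hc x' i) => // k.
  by rewrite mevalXU segreE.
Qed.

Lemma regular_pair (T : variety) (f : T -> X) (g : T -> Y) :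
  regular f -> regular g -> @regular T prodv (fun t => (f t, g t)).
Proof.
move=> rf rg t; have [d [F [hF Ft Fp]]] := rf t.
have [e [G [hG Gt Gp]]] := rg t.
pose H k : {mpoly K[hdim (pstr T)]} := mxvec (\matrix_(i, j) (F i * G j)) 0 k.
have HE t' k : (H k).@[hc t'] =
    segre (fun i => (F i).@[hc t']) (fun j => (G j).@[hc t']) k.
  by case/mxvec_indexP: k => i j; rewrite segreE /H mxvecE mxE mevalM.
exists (d + e)%N, H; split.
- case/mxvec_indexP=> i j; rewrite /H mxvecE mxE; exact: dhomogM.
- by have [k hk] := nonzero_segre Ft Gt; exists k; rewrite HE.
- move=> t'; case=> k; rewrite HE => nz.
  have [|Ft' Gt'] := @segre_nonzero _ _ _ (fun i => (F i).@[hc t'])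
    (fun j => (G j).@[hc t']); first by exists k.
  have [c c0 E] := proportional_segre (Fp t' Ft') (Gp t' Gt').
  by exists c => // l; rewrite HE -E.
Qed.

End Product.
Lemma prod_map_regular (X Y X' Y' : variety) (f : X -> X') (g : Y -> Y') :
  regular f -> regular g ->
  @regular (prodv X Y) (prodv X' Y') (fun z => (f z.1, g z.2)).
Proof.
move=> rf rg; apply: (@regular_pair X' Y' (prodv X Y)).
  exact: (regular_comp (@regular_fst X Y) rf).
exact: (regular_comp (@regular_snd X Y) rg).
Qed.

Record abelian_variety := AbelianVariety {
  abpoints :> zmodType;
  abstr : projective_structure abpoints;
  ab_irreducible : irreducible_variety (Variety abstr);
  ab_opp_regular :
    @regular (Variety abstr) (Variety abstr) (fun x => - x);
  ab_add_regular :
    @regular (prodv (Variety abstr) (Variety abstr)) (Variety abstr)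
      (fun z => z.1 + z.2)
}.

Definition abvar (A : abelian_variety) : variety := Variety (abstr A).

Section TrivialAbelianVariety.

Let one_coord (_ : 'I_1) (_ : 'I_1) : K := 1.

Lemma unit_nonzero x : nonzero (one_coord x).
Proof. by exists ord0; exact: oner_neq0. Qed.

Lemma unit_inj x y : proportional (one_coord x) (one_coord y) -> x = y.
Proof. by rewrite (ord1 x) (ord1 y). Qed.

Lemma unit_closed : exists S : {mpoly K[1]} -> Prop,
  (forall p, S p -> exists d, p \is d.-homog) /\
  forall v, nonzero v ->
    ((forall p, S p -> p.@[v] = 0) <-> exists x, proportional v (one_coord x)).
Proof.
exists (fun _ => False); split=> // v [i vi]; split=> // _.
by exists ord0, (v i) => // j; rewrite mulr1 (ord1 i) (ord1 j).
Qed.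

Definition unit_structure : projective_structure 'I_1 :=
  ProjectiveStructure unit_nonzero unit_inj unit_closed.

Let unitv : variety := Variety unit_structure.

Lemma unit_irreducible : irreducible_variety unitv.
Proof.
split=> [|Z1 Z2 _ _ cov]; first by exists ord0.
by case: (cov ord0 I) => H; [left|right]; move=> x _; rewrite (ord1 x).
Qed.

Lemma unit_regular (X : variety) (f : X -> unitv) : regular f.
Proof.
move=> x; exists 0%N, (fun _ => 1); split.
- by move=> _; exact: dhomog1.
- by exists ord0; rewrite meval1 oner_neq0.
- by move=> x' _; exists 1; rewrite ?oner_neq0 // => i; rewrite meval1 mulr1.
Qed.

Definition trivial_ab : abelian_variety :=
  @AbelianVariety 'I_1 unit_structure unit_irreducible
    (@unit_regular _ _) (@unit_regular _ _).

End TrivialAbelianVariety.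

Section ProductAbelianVariety.
Variables A B : abelian_variety.

Let V := prodv (abvar A) (abvar B).

Lemma prod_ab_opp : @regular V V (fun x => (- x.1, - x.2)).
Proof.
exact: prod_map_regular (@ab_opp_regular A) (@ab_opp_regular B).
Qed.

Lemma prod_ab_add :
  @regular (prodv V V) V (fun z => (z.1.1 + z.2.1, z.1.2 + z.2.2)).
Proof.
apply: (@regular_pair (abvar A) (abvar B) (prodv V V)).
- apply: (@regular_comp _ (prodv (abvar A) (abvar A)) _
    (fun z : prodv V V => (z.1.1, z.2.1)) _ _ (@ab_add_regular A)).
  by apply: prod_map_regular; exact: regular_fst.
- apply: (@regular_comp _ (prodv (abvar B) (abvar B)) _
    (fun z : prodv V V => (z.1.2, z.2.2)) _ _ (@ab_add_regular B)).
  by apply: prod_map_regular; exact: regular_snd.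
Qed.

Definition prod_ab : abelian_variety :=
  @AbelianVariety (A * B)%type (prod_structure (abvar A) (abvar B))
    (prod_irreducible (@ab_irreducible A) (@ab_irreducible B))
    prod_ab_opp prod_ab_add.

End ProductAbelianVariety.

Definition big_prod_ab (s : seq abelian_variety) : abelian_variety :=
  foldr prod_ab trivial_ab s.

Definition homomorphism (A B : abelian_variety) (f : A -> B) : Prop :=
  @regular (abvar A) (abvar B) f /\ forall x y, f (x + y) = f x + f y.

Definition isogeny (A B : abelian_variety) (f : A -> B) : Prop :=
  [/\ homomorphism f, forall b, exists a, f a = b
    & exists s : seq A, forall a, f a = 0 -> a \in s].

Definition isogenous (A B : abelian_variety) : Prop :=
  exists f : A -> B, isogeny f.

(* The abelian subvariety of A with set of points Z, given as an abelian
   variety B with an embedding i : B -> A. *)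
Definition abelian_subvariety (A B : abelian_variety) (i : B -> A)
    (Z : A -> Prop) : Prop :=
  [/\ homomorphism i, @closed_immersion (abvar B) (abvar A) i
    & forall a, Z a <-> exists b, i b = a].

Section Divisors.
Variable X : variety.
Local Notation poly := {mpoly K[hdim (pstr X)]}.

(* The k-th power of the homogeneous ideal of the point x. *)
Inductive point_ideal_power (x : X) : nat -> poly -> Prop :=
| PointIdealPower0 p : point_ideal_power x 0 p
| PointIdealPowerM k d p q :
    p \is d.-homog -> p.@[hc x] = 0 -> point_ideal_power x k q ->
    point_ideal_power x k.+1 (p * q)
| PointIdealPowerD k p q :
    point_ideal_power x k p -> point_ideal_power x k q ->
    point_ideal_power x k (p + q).

(* F is a form of degree d; its germ at x, trivialized by any form of degree d
   not vanishing at x, lies in the k-th power of the maximal ideal of the local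
   ring of X at x. *)
Definition order_at_least (x : X) (d : nat) (F : poly) (k : nat) : Prop :=
  exists (e : nat) (w P : poly),
    [/\ w \is e.-homog, w.@[hc x] != 0, P \is (e + d).-homog,
        point_ideal_power x k P & vanishes_on (w * F - P)].

Definition has_order (x : X) (d : nat) (F : poly) (k : nat) : Prop :=
  order_at_least x d F k /\ ~ order_at_least x d F k.+1.

(* Effective divisors are given as lists of points; s and t are equivalent
   when s - t is the divisor of the rational function F / G. *)
Definition linearly_equivalent (s t : seq X) : Prop :=
  exists (d : nat) (F G : poly),
    [/\ F \is d.-homog, G \is d.-homog, ~ vanishes_on F, ~ vanishes_on G
      & forall x, exists m n,
          [/\ has_order x d F m, has_order x d G n
            & (m + count_mem x t = n + count_mem x s)%N]].

End Divisors.

(* J is Pic^0 X, the class of the divisor x - y being u x - u y, with the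
   structure of abelian variety for which the Abel-Jacobi maps
   x |-> [x - x0] = u x - u x0 are regular and universal among regular maps
   to abelian varieties. The map u itself is thus only determined up to a
   translation. *)
Record is_jacobian (X : variety) (J : abelian_variety) (u : X -> J) : Prop := {
  jacobian_regular : @regular X (abvar J) u;
  jacobian_equiv : forall s t : seq X, size s = size t ->
    \sum_(x <- s) u x = \sum_(x <- t) u x <-> linearly_equivalent s t;
  jacobian_surj : forall a : J, exists s t : seq X,
    size s = size t /\ a = \sum_(x <- s) u x - \sum_(x <- t) u x;
  jacobian_universal : forall (A : abelian_variety) (f : X -> A),
    @regular X (abvar A) f ->
    exists2 h : J -> A, homomorphism h &
      exists c, forall x, f x = h (u x) + c
}.

(* Nm f maps the class of x - y to the class of f x - f y. *)
Definition is_norm_map (X Y : variety) (f : X -> Y)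
    (JX JY : abelian_variety) (uX : X -> JX) (uY : Y -> JY)
    (nm : JX -> JY) : Prop :=
  homomorphism nm /\
  forall x y, nm (uX x - uX y) = uY (f x) - uY (f y).

(* P, embedded in JX by i, is the Prym variety of a morphism X -> Y with norm
   map nm. *)
Definition is_prym (JX JY : abelian_variety) (nm : JX -> JY)
    (P : abelian_variety) (i : P -> JX) : Prop :=
  abelian_subvariety i
    (@connected_component (abvar JX) (fun a => nm a = 0) 0).

Section Quotient.
Variables (gT : finGroupType) (X : variety) (to : {action gT &-> X}).

(* Groups act on the right, as do their matrix representations on row vectors;
   composition in Aut(X) is thus written in diagrammatic order. *)
Definition acts_by_automorphisms : Prop :=
  (forall g, regular (fun x => to x g)) /\
  (forall g, (forall x, to x g = x) -> g = 1%g).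

Definition is_quotient (M : {set gT}) (Y : variety) (q : X -> Y) : Prop :=
  [/\ regular q,
      forall y, exists x, q x = y,
      forall x x', q x = q x' <-> exists2 g, g \in M & x' = to x g
    & forall (Z : variety) (f : X -> Z), regular f ->
        (forall x g, g \in M -> f (to x g) = f x) ->
        exists2 f' : Y -> Z, regular f' & forall x, f' (q x) = f x].

End Quotient.

End Varieties.

Section RationalGroupRing.
Variable gT : finGroupType.
Local Notation G := [set: gT]%G.

Definition gring_coef (A : 'M[rat]_#|G|) (g : gT) : rat :=
  gring_row A 0 (gring_index G g).

(* The row space of rG as a vector space over D = End_G, acting on the right
   by the matrices in the centraliser of rG. *)
Definition is_End_basis d (rG : mx_representation rat G d) n
    (w : 'I_n -> 'rV[rat]_d) : Prop :=
  forall v : 'rV[rat]_d, exists! c : {ffun 'I_n -> 'M[rat]_d},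
    (forall k, centgmx rG (c k)) /\ v = \sum_k w k *m c k.

(* The element of the simple factor of Q[G] attached to i that acts on W_i as
   the matrix unit E_11 with respect to some D_i-basis of W_i. *)
Definition is_primitive_idempotent (sG : irrType rat G) (i : sG)
    (p : 'M[rat]_#|G|) : Prop :=
  (p \in Wedderburn_subring i)%MS /\
  exists n (w : 'I_n.+1 -> 'rV[rat]_(irr_degree i)),
    is_End_basis (irr_repr i) w /\
    forall k, w k *m gring_op (irr_repr i) p = if k == ord0 then w k else 0.

(* Im(p) for p in Q[G] acting on J through the action rho of G, computed from
   z = m p in Z[G] for some positive integer m. *)
Definition is_gring_image (J : zmodType) (rho : gT -> J -> J)
    (p : 'M[rat]_#|G|) (Z : J -> Prop) : Prop :=
  exists (m : nat) (z : gT -> int),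
    [/\ (0 < m)%N, forall g, (z g)%:~R = m%:R * gring_coef p g
      & forall b, Z b <-> exists a, b = \sum_g rho g a *~ z g].

End RationalGroupRing.

(* Main.v *)
(* The norm f and the pullback t of X -> X_M satisfy t f = sum of M and
   f t = |M|, so, up to isogeny, P(X_M/X_N) is the image in JX of the
   idempotent e = e_M - e_N of Q[G], where e_H is the mean of the subgroup H.
   Splitting primitive idempotents off e one at a time gives a_k, b_k in Q[G]
   with sum_k a_k b_k = e and b_k a_l = p_(i_k) if k = l, and 0 otherwise; no
   i_k is trivial since e acts by zero on the trivial representation. After
   clearing denominators a_k and b_k give homomorphisms P -> B_(i_k) and
   B_(i_k) -> P which are inverse to each other up to a multiplication [n] by a
   nonzero integer. What remains is that [n] has a finite kernel and is
   surjective on an abelian variety. In suitable local coordinates [n] has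
   differential n at 0, so 0 is isolated among the n-torsion points, which are
   therefore finitely many. The closed subgroups n^k A become stationary by
   Hilbert's basis theorem, so that A is the union of finitely many translates
   of some n^k A, and A = n^k A because A is irreducible. *)
Require Import Defs.
From mathcomp Require Import all_boot all_order all_algebra all_fingroup.
From mathcomp Require Import all_solvable all_character.
From mathcomp Require Import boolp closed_field mpoly ring.
Import GRing.Theory.
Local Open Scope ring_scope.

Set Implicit Arguments.
Unset Strict Implicit.
Unset Printing Implicit Defensive.

(** * Hilbert's basis theorem *)

(** The argument stays with points, forms and regular functions. The differential of [n] at 0 is
    replaced by an exact expansion of the coordinates of n x, whose coefficients are regular
    functions forming a matrix with value n times the identity at 0. That the subgroups n^k A are
    closed comes from Chevalley's theorem, here quantifier elimination over K: the image of a
    homomorphism contains a nonempty open subset of its closure, and translations extend this to the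
    whole closure.

    The Noetherian property enters three times: to replace the equations of A by a finite list,
    which a first-order formula requires, to stop descending chains of closed sets, and to show that
    a set of isolated points is finite.

    In the isogeny all denominators are cleared by one integer D. Each of the composed maps then
    contributes a known integer factor, and these factors make up the two torsion bounds of the
    proof: D^4 |M| for surjectivity and D^3 |M| for the kernel. *)

Section Noetherian.
Implicit Types R S : comNzRingType.

Definition is_ideal R (J : R -> Prop) : Prop :=
  [/\ J 0, forall x y, J x -> J y -> J (x + y) & forall a x, J x -> J (a * x)].

(** The list of coefficients may have any length, since missing entries read as 0. *)
Definition spanned R (l : seq R) (x : R) : Prop :=
  exists c : seq R, x = \sum_(i < size l) c`_i * l`_i.

Definition noetherian R : Prop :=
  forall J : R -> Prop, is_ideal J ->
    exists2 l : seq R, (forall x, x \in l -> J x) & forall x, J x -> spanned l x.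

Lemma spanned_ideal R (l : seq R) : is_ideal (spanned l).
Proof.
split=> [|x y [c ->] [d ->]|a x [c ->]].
- by exists [::]; rewrite big1 // => i _; rewrite nth_nil mul0r.
- exists (mkseq (fun i => c`_i + d`_i) (size l)); rewrite -big_split /=.
  by apply: eq_bigr => i _; rewrite nth_mkseq // mulrDl.
- exists (mkseq (fun i => a * c`_i) (size l)); rewrite mulr_sumr.
  by apply: eq_bigr => i _; rewrite nth_mkseq // mulrA.
Qed.

Lemma spanned_mem R (l : seq R) x : x \in l -> spanned l x.
Proof.
move=> xl; have lt := xl; rewrite -index_mem in lt.
exists (mkseq (fun i => (i == index x l)%:R) (size l)).
rewrite (bigD1 (Ordinal lt)) //= nth_mkseq // eqxx mul1r nth_index //.
rewrite big1 ?addr0 // => i; rewrite -val_eqE /= => /negPf ni.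
by rewrite nth_mkseq // ni mul0r.
Qed.

Lemma ideal_sum R (J : R -> Prop) (T : Type) (r : seq T) (F : T -> R) :
  is_ideal J -> (forall i, J (F i)) -> J (\sum_(i <- r) F i).
Proof.
by case=> I0 ID _ IF; elim/big_rec: _ => // i x _ Ix; apply: ID.
Qed.

Lemma spanned_min R (J : R -> Prop) (l : seq R) x :
  is_ideal J -> (forall y, y \in l -> J y) -> spanned l x -> J x.
Proof.
move=> idI lI [c ->]; apply: ideal_sum => // i.
by case: idI => _ _ IM; apply/IM/lI/mem_nth.
Qed.

(** The ascending chain condition in the form used below: the initial segments of [p] span an
    increasing chain of ideals, and the finitely many generators of its union already lie in one of
    them. *)
Lemma noetherian_seq R (p : nat -> R) :
  noetherian R -> exists k, spanned (mkseq p k) (p k).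
Proof.
move=> nR; pose J x := exists k, spanned (mkseq p k) x.
have mono k m x : (k <= m)%N -> spanned (mkseq p k) x -> spanned (mkseq p m) x.
  move=> km; apply: spanned_min; first exact: spanned_ideal.
  move=> y; rewrite /mkseq => /mapP[i]; rewrite mem_iota /= => ik ->; apply: spanned_mem.
  by rewrite map_f // mem_iota /= (leq_trans ik).
have idI : is_ideal J.
  split=> [|x y [k xk] [m ym]|a x [k xk]].
  - by exists 0%N; case: (spanned_ideal (mkseq p 0)).
  - exists (maxn k m); case: (spanned_ideal (mkseq p (maxn k m))) => _ + _.
    by apply; [apply: mono xk|apply: mono ym]; rewrite ?leq_maxl ?leq_maxr.
  - by exists k; case: (spanned_ideal (mkseq p k)) => _ _; apply.
have [l lI Il] := nR J idI.
have [k lk] : exists k, forall x, x \in l -> spanned (mkseq p k) x.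
  elim: l lI {Il} => [|y l IH] lI; first by exists 0%N.
  have [|k lk] := IH; first by move=> x xl; apply: lI; rewrite inE xl orbT.
  have [|m ym] := lI y; first by rewrite mem_head.
  exists (maxn k m) => x; rewrite inE => /predU1P[->|/lk xk].
    by apply: mono ym; rewrite leq_maxr.
  by apply: mono xk; rewrite leq_maxl.
exists k; apply: spanned_min lk _; first exact: spanned_ideal.
by apply: Il; exists k.+1; apply: spanned_mem; rewrite map_f // mem_iota /=.
Qed.

Lemma noetherian_surj R S (f : {rmorphism R -> S}) :
  (forall y, exists x, f x = y) -> noetherian R -> noetherian S.
Proof.
move=> fsurj nR J [I0 ID IM].
have [|l lI Il] := nR (fun x => J (f x)).
  split=> [|x y|a x]; rewrite ?rmorph0 ?rmorphD ?rmorphM //.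
    exact: ID.
  exact: IM.
exists (map f l) => [_ /mapP[x xl ->]|y Iy]; first exact: lI.
have [x fx] := fsurj y; have [|c xE] := Il x; first by rewrite fx.
exists (map f c); rewrite -fx xE rmorph_sum size_map /=.
apply: eq_bigr => i _; rewrite rmorphM.
suff nthf (t : seq R) (j : nat) : (map f t)`_j = f t`_j by rewrite !nthf.
have [jt|jt] := ltnP j (size t); first by rewrite (nth_map 0).
by rewrite !nth_default ?size_map // rmorph0.
Qed.

Lemma noetherian_field (F : fieldType) : noetherian F.
Proof.
move=> J [I0 ID IM]; have [[x Ix x0]|nI] := pselect (exists2 x, J x & x != 0).
  exists [:: x] => [y|y Iy]; first by rewrite inE => /eqP ->.
  by exists [:: y / x]; rewrite big_ord1 /= mulfVK.
exists [::] => // x Ix; exists [::]; rewrite big_ord0.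
by apply/eqP/negPn/negP => x0; apply: nI; exists x.
Qed.

(* Hilbert's basis theorem: if J were not finitely generated, choosing again
   and again an element of least degree outside the ideal generated by the
   previous ones gives leading coefficients none of which is in the ideal
   generated by the previous ones. *)
Lemma noetherian_poly R : noetherian R -> noetherian {poly R}.
Proof.
move=> nR J idI; apply: contrapT => notfg.
(* The condition on [l] stands inside the existential so that [choice] yields a function on all
   lists; on lists not contained in [J] its value is arbitrary. *)
have next (l : seq {poly R}) : exists q, (forall x, x \in l -> J x) ->
    [/\ J q, ~ spanned l q &
        forall r, J r -> ~ spanned l r -> (size q <= size r)%N].
  have [lI|nlI] := pselect (forall x, x \in l -> J x); last by exists 0.
  have [r0 Ir0 nr0] : exists2 r, J r & ~ spanned l r.
    apply: contrapT => nr; apply: notfg; exists l => // x Ix.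
    by apply: contrapT => nx; apply: nr; exists x.
  pose Q d := `[< exists2 r, J r /\ ~ spanned l r & size r = d >].
  have exQ : exists d, Q d by exists (size r0); apply/asboolP; exists r0.
  case: (ex_minnP exQ) => d /asboolP[q [Iq nq] qd] dmin.
  exists q => _; split=> // r Ir nr; rewrite qd; apply: dmin.
  by apply/asboolP; exists r.
have [F FP] := choice next.
pose L k := iter k (fun l => rcons l (F l)) [::].
pose f k := F (L k).
have LE k : L k = mkseq f k by elim: k => // k IH; rewrite mkseqS -IH.
have LI k x : x \in L k -> J x.
  elim: k x => // k IH x; rewrite [L _]/= mem_rcons inE => /predU1P[->|/IH //].
  by have [] := FP _ IH.
have fP k := FP _ (LI k).
have fsize j k : (j <= k)%N -> (size (f j) <= size (f k))%N.
  move=> jk; have [_ _] := fP j; apply; first by have [] := fP k.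
  have [_ nk _] := fP k => jf; apply: nk; apply: spanned_min jf.
    exact: spanned_ideal.
  move=> x; rewrite LE /mkseq => /mapP[i]; rewrite mem_iota /= => ij ->.
  by apply: spanned_mem; rewrite LE map_f // mem_iota /= (leq_trans ij).
have [k [c lk]] := noetherian_seq (fun j => lead_coef (f j)) nR.
rewrite size_mkseq in lk.
(* By [lk] the shifted sum [s] has the same leading term as [f k]. So [f k - s] is smaller than
   [f k] but, like it, in [J] and outside the ideal spanned by [L k], against minimality. *)
pose s := \sum_(j < k) (c`_j *: 'X^(size (f k) - size (f j))) * f j.
have [Ik nk kmin] := fP k; have [_ ID IM] := idI.
have sk : spanned (L k) s.
  rewrite /s; apply: ideal_sum; first exact: spanned_ideal.
  move=> j; case: (spanned_ideal (L k)) => _ _; apply; apply: spanned_mem.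
  by rewrite LE map_f // mem_iota /=.
have Is : J s by apply: spanned_min sk => // x; apply: LI.
have fk0 : f k != 0.
  apply/eqP => fk0; apply: nk; rewrite -/(f k) fk0.
  by case: (spanned_ideal (L k)).
have : (size (f k) <= size (f k - s)%R)%N.
  apply: kmin; first by rewrite -mulN1r; apply: ID => //; apply: IM.
  move=> h; apply: nk; have [_ SD _] := spanned_ideal (L k).
  by rewrite -/(f k) -(subrK s (f k)); apply: SD.
apply/negP; rewrite -ltnNge.
case E: (size (f k)) => [|n]; first by move/eqP: E; rewrite size_poly_eq0 (negPf fk0).
rewrite ltnS; apply/leq_sizeP => m.
have fm j m' : (size (f k) <= m')%N -> (f j)`_(m' - (size (f k) - size (f j)))
   = 0 \/ (k < j)%N.
  move=> mk; case: (leqP j k) => jk; last by right.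
  left; apply: nth_default; apply: (leq_trans _ (leq_sub2r _ mk)).
  by rewrite subKn // fsize.
rewrite leq_eqVlt => /predU1P[<-|nm].
  rewrite coefB /s coef_sum -[(f k)`_n]/((f k)`_(n.+1.-1)) -E -/(lead_coef _) lk.
  apply/eqP; rewrite subr_eq0; apply/eqP; apply: eq_bigr => j _.
  rewrite nth_mkseq // -scalerAl coefZ coefXnM; congr (_ * _).
  have jk := fsize _ _ (ltnW (ltn_ord j)).
  have fj0 : (0 < size (f j))%N.
    rewrite lt0n size_poly_eq0; apply/eqP => fj0.
    by have [_ + _] := fP j; rewrite -/(f j) fj0; case: (spanned_ideal (L j)).
  rewrite ltnNge E; have -> : (n.+1 - size (f j) <= n)%N.
    by rewrite leq_subLR -add1n leq_add2r.
  rewrite /lead_coef /=; congr (_`_ _).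
  by rewrite E in jk; rewrite -{2}(prednK fj0) subSS subKn // -ltnS prednK.
rewrite coefB nth_default ?E // sub0r coef_sum big1 ?oppr0 // => j _.
rewrite -scalerAl coefZ coefXnM; case: ifP => _; first by rewrite mulr0.
have [|->|] := fm j m; rewrite ?E ?mulr0 //.
by rewrite ltnNge ltnW.
Qed.

Lemma noetherian_mpoly (F : fieldType) n : noetherian {mpoly F[n]}.
Proof.
elim: n => [|n IH].
  apply: (@noetherian_surj F _ (@mpolyC 0 F)); last exact: noetherian_field.
  move=> p; exists p@_0%MM; rewrite [RHS]mpolyE.
  have [->|p0] := eqVneq p 0; first by rewrite mcoeff0 msupp0 big_nil.
  have -> : msupp p = [:: 0%MM].
    apply: perm_small_eq => //; apply: uniq_perm => // m.
    have -> : m = 0%MM by apply/mnmP; case.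
    rewrite mem_head mcoeff_msupp; apply: contraNneq p0 => c0.
    apply/eqP/mpolyP => m'; rewrite mcoeff0 -[RHS]c0; congr (p@__).
    by apply/mnmP; case.
  by rewrite big_seq1 mpolyX0 alg_mpolyC.
(* The variable of the univariate ring becomes the last variable. A quotient of a Noetherian ring is
   Noetherian, so surjectivity of [f] suffices. *)
pose f : {rmorphism {poly {mpoly F[n]}} -> {mpoly F[n.+1]}} :=
  (horner_eval 'X_ord_max \o map_poly (@mwiden n F))%FUN.
apply: (@noetherian_surj {poly {mpoly F[n]}} _ f); last exact: noetherian_poly.
move=> p; elim/mpolyind: p => [|c m p _ _ [q <-]]; first by exists 0; rewrite rmorph0.
suff [r fr] : exists r, f r = c *: 'X_[m] by exists (r + q); rewrite rmorphD fr.
have fX i : exists r, f r = 'X_i.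
  case: (unliftP ord_max i) => [j|] ->.
    exists ('X_j)%:P; rewrite /f /= /horner_eval map_polyC hornerC /= mwidenX mnmwiden1.
    by congr ('X_[U_(_)]); apply: val_inj; rewrite /= /bump leqNgt ltn_ord.
  by exists 'X; rewrite /f /= /horner_eval map_polyX hornerX.
have [r rX] := choice fX.
exists ((c%:MP)%:P * \prod_i r i ^+ m i); rewrite rmorphM rmorph_prod.
have -> : f (c%:MP)%:P = c%:MP.
  by rewrite /f /= /horner_eval map_polyC hornerC /= mwidenC.
rewrite mul_mpolyC mpolyXE_id; congr (_ *: _).
by apply: eq_bigr => i _; rewrite rmorphXn rX.
Qed.

End Noetherian.

(** * Regular maps and Zariski closed sets *)

Section Regular.
Variable K : closedFieldType.
Implicit Types X Y Z : variety K.

(** Stated for arbitrary families of coordinates: the inverse of a closed immersion is locally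
    polynomial in the coordinates of the image points, a family other than [hc] of its source. *)
Lemma locally_polynomial_comp (T S : Type) n m l (a : T -> 'I_n -> K)
    (b : S -> 'I_m -> K) (c : S -> 'I_l -> K) (g : T -> S) :
  locally_polynomial a (fun t => b (g t)) -> locally_polynomial b c ->
  locally_polynomial a (fun t => c (g t)).
Proof.
move=> rf rg x; have [d [F [hF [i Fi] Fp]]] := rf x.
have [e [G [hG Gy Gp]]] := rg (g x).
have GE x' k j : (forall i, b (g x') i = k * (F i).@[a x']) ->
    (G j).@[b (g x')] = k ^+ e * (subst (G j) F).@[a x'].
  by move=> E; rewrite meval_subst; apply: homog_scale.
exists (d + d * e)%N, (fun j => F i * subst (G j) F); split.
- by move=> j; apply: dhomogM => //; apply: homog_subst.
- have [k k0 E] := Fp x (ex_intro _ i Fi).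
  have [j] := Gy; rewrite (GE _ _ _ E) mulf_eq0 negb_or => /andP[_ Gj].
  by exists j; rewrite mevalM mulf_neq0.
- move=> x'; case=> j; rewrite mevalM mulf_eq0 negb_or => /andP[Fi' Gj'].
  have [k k0 E] := Fp x' (ex_intro _ i Fi').
  have [|h h0 E'] := Gp (g x').
    by exists j; rewrite (GE _ _ _ E) mulf_neq0 // expf_eq0 (negPf k0) andbF.
  exists (h * k ^+ e / (F i).@[a x']).
    by rewrite !mulf_neq0 ?invr_eq0 // expf_eq0 (negPf k0) andbF.
  by move=> j'; rewrite E' (GE _ _ _ E) mevalM -!mulrA mulKf.
Qed.

Lemma regular_factor X Y Z (i : Y -> Z) (g : X -> Y) :
  closed_immersion i -> regular (i \o g) -> regular g.
Proof.
case=> _ _ ri rg; exact: (@locally_polynomial_comp X Y _ _ _ (@hc _ X)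
  (fun y => hc (i y)) (@hc _ Y) g rg ri).
Qed.

Lemma regular_id X : regular (fun x : X => x).
Proof.
move=> x; exists 1%N, (fun j => 'X_j); split=> [j||x' _].
- exact: homogU.
- by have [j xj] := hc_nonzero x; exists j; rewrite mevalXU.
- by exists 1 => [|j]; rewrite ?oner_neq0 // mevalXU mul1r.
Qed.

Lemma regular_const X Y (y : Y) : regular (fun _ : X => y).
Proof.
move=> x; exists 0%N, (fun j => (hc y j)%:MP); split=> [j||x' _].
- by rewrite -[X in X \is _]alg_mpolyC; apply: rpredZ; exact: dhomog1.
- by have [j yj] := hc_nonzero y; exists j; rewrite mevalC.
- by exists 1 => [|j]; rewrite ?oner_neq0 // mevalC mul1r.
Qed.

Lemma zclosed_form X d (p : {mpoly K[hdim (pstr X)]}) :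
  p \is d.-homog -> zclosed (fun x : X => p.@[hc x] = 0).
Proof.
move=> hp; exists (fun q => q = p); split=> [_ ->|x]; first by exists d.
by split=> [px _ -> //|]; apply.
Qed.

(** Pulled-back equations are only local. Multiplying one by a component [F j] of the local
    representation makes it vanish outside the domain of that representation, so it vanishes on the
    whole preimage and counts among the chosen equations. *)
Lemma zclosed_preimage X Y (f : X -> Y) (Z : Y -> Prop) :
  regular f -> zclosed Z -> zclosed (fun x => Z (f x)).
Proof.
move=> rf [S [homS HS]].
exists (fun q => (exists d, q \is d.-homog) /\
                 forall x, Z (f x) -> q.@[hc x] = 0); split=> [q []//|x].
split=> [Zx q [_]|Hx]; first exact.
apply/HS => p Sp; have [e hp] := homS p Sp.
have [d [F [hF [j Fj] Fp]]] := rf x.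
have fE x' : nonzero (fun j => (F j).@[hc x']) ->
    p.@[hc (f x')] = 0 <-> (subst p F).@[hc x'] = 0.
  by move=> nz; rewrite meval_subst; apply: homog_proportional hp (Fp x' nz).
apply/fE; first by exists j.
have /Hx : (exists d', F j * subst p F \is d'.-homog) /\
    (forall x', Z (f x') -> (F j * subst p F).@[hc x'] = 0).
  split; first by exists (d + d * e)%N; apply: dhomogM => //; apply: homog_subst.
  move=> x' Zx'; rewrite mevalM; have [->|Fj'] := eqVneq (F j).@[hc x'] 0.
    by rewrite mul0r.
  have nz : nonzero (fun j => (F j).@[hc x']) by exists j.
  by rewrite (proj1 (fE _ nz)) ?mulr0 //; move/HS: Zx'; apply.
by rewrite mevalM => /eqP; rewrite mulf_eq0 (negPf Fj) => /eqP.
Qed.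

Lemma zclosedU X (Z1 Z2 : X -> Prop) :
  zclosed Z1 -> zclosed Z2 -> zclosed (fun x => Z1 x \/ Z2 x).
Proof.
move=> [S1 [hom1 H1]] [S2 [hom2 H2]].
exists (fun q => exists p1 p2, [/\ S1 p1, S2 p2 & q = p1 * p2]).
split=> [_ [p1 [p2 [/hom1[d1 h1] /hom2[d2 h2] ->]]]|x].
  by exists (d1 + d2)%N; apply: dhomogM.
split=> [Zx _ [p1 [p2 [Sp1 Sp2 ->]]]|Hx].
  rewrite mevalM; case: Zx => [/H1 Z|/H2 Z]; first by rewrite Z ?mul0r.
  by rewrite [X in _ * X]Z ?mulr0.
apply: contrapT => /not_orP[n1 n2]; apply: n1; apply/H1 => p1 Sp1.
apply: contrapT => /eqP p1x; apply: n2; apply/H2 => p2 Sp2.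
have /eqP : (p1 * p2).@[hc x] = 0 by apply: Hx; exists p1, p2.
by rewrite mevalM mulf_eq0 (negPf p1x) => /eqP.
Qed.

Lemma zclosed_big_union X (T : eqType) (r : seq T) (Z : T -> X -> Prop) :
  (forall q, q \in r -> zclosed (Z q)) ->
  zclosed (fun x => exists2 q, q \in r & Z q x).
Proof.
elim: r => [|q r IH] Zc.
  exists (fun p => p = 1); split=> [_ ->|x]; first by exists 0%N; exact: dhomog1.
  split=> [[]//|/(_ _ (erefl _))/eqP].
  by rewrite meval1 oner_eq0.
have [|S [homS HS]] := zclosedU (Zc q (mem_head _ _)) (IH _).
  by move=> q' q'r; apply: Zc; rewrite inE q'r orbT.
exists S; split=> // x; rewrite -HS; split=> [[q']|[Zq|[q' q'r Zq]]].
- by rewrite inE => /predU1P[-> Zq|q'r Zq]; [left|right; exists q'].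
- by exists q; rewrite ?mem_head.
- by exists q'; rewrite // inE q'r orbT.
Qed.

Lemma irreducible_cover X (T : eqType) (r : seq T) (Z : T -> X -> Prop) :
  irreducible_variety X -> (forall q, q \in r -> zclosed (Z q)) ->
  (forall x, exists2 q, q \in r & Z q x) ->
  exists2 q, q \in r & forall x, Z q x.
Proof.
move=> [[x0 _] irX] Zc cov.
elim: r Zc cov => [|q r IH] Zc cov; first by have [] := cov x0.
have rc q' : q' \in r -> zclosed (Z q').
  by move=> q'r; apply: Zc; rewrite inE q'r orbT.
have [x _|Zq|Zr] := irX _ _ (Zc q (mem_head _ _)) (zclosed_big_union rc).
- have [q' + Zq'] := cov x; rewrite inE => /predU1P[<-|q'r]; first by left.
  by right; exists q'.
- by exists q; rewrite ?mem_head // => x; apply: Zq.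
- have [q' q'r Zq'] := IH rc (fun x => Zr x Logic.I).
  by exists q'; rewrite // inE q'r orbT.
Qed.

Lemma irreducible_generic X (T : eqType) (r : seq T) (Z : T -> X -> Prop) :
  irreducible_variety X -> (forall q, q \in r -> zclosed (Z q)) ->
  (forall q, q \in r -> exists x, ~ Z q x) ->
  exists x, forall q, q \in r -> ~ Z q x.
Proof.
move=> irX Zc nZ; apply: contrapT => /forallNP nx.
have [|q qr Zq] := irreducible_cover irX Zc.
- by move=> x; have /existsNP[q /not_implyP[qr /contrapT Zq]] := nx x; exists q.
- by have [x []] := nZ q qr.
Qed.

Lemma homogenize n (p : {mpoly K[n]}) (i : 'I_n) :
  exists d, exists2 q : {mpoly K[n]}, q \is d.-homog &
    forall v, v i != 0 -> q.@[v] = v i ^+ d * p.@[fun j => v j / v i].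
Proof.
elim/mpolyind: p => [|c m p _ _ [d [q hq qE]]].
  by exists 0%N, 0 => [|v _]; rewrite ?rpred0 // !meval0 mulr0.
(* The degree is the sum, not the maximum, of the degrees of the monomials; each side is padded with
   the power of ['X_i] that the other one needs. *)
exists (mdeg m + d)%N, (c *: 'X_[m] * 'X_i ^+ d + 'X_i ^+ mdeg m * q).
  apply: rpredD; apply: dhomogM => //.
  - by apply: rpredZ; rewrite dhomogX.
  - by have := dhomogMn d (homogU K i); rewrite mul1n.
  - by have := dhomogMn (mdeg m) (homogU K i); rewrite mul1n.
move=> v vi; rewrite !mevalD !mevalM !mevalZ !rmorphXn /= mevalXU qE // !mevalX.
have -> : \prod_(j < n) v j ^+ m j =
    v i ^+ mdeg m * \prod_(j < n) (v j / v i) ^+ m j.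
  rewrite mdegE -prodrXr -big_split /=.
  by apply: eq_bigr => j _; rewrite -exprMn mulrCA divff ?mulr1.
by rewrite exprD; ring.
Qed.

Lemma meval_spanned n (v : 'I_n -> K) (l : seq {mpoly K[n]}) p :
  (forall q, q \in l -> q.@[v] = 0) -> spanned l p -> p.@[v] = 0.
Proof.
apply: (@spanned_min _ (fun q => q.@[v] = 0)).
split=> [|x y x0 y0|a x x0]; first exact: meval0.
  by rewrite mevalD x0 y0 addr0.
by rewrite mevalM x0 mulr0.
Qed.

(** Otherwise one could choose again and again a polynomial of [S] and a common zero of the earlier
    ones at which it does not vanish; no such polynomial is in the span of the earlier ones. *)
Lemma vanishing_finite n (S : {mpoly K[n]} -> Prop) :
  exists2 l : seq {mpoly K[n]}, (forall p, p \in l -> S p) &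
    forall v, (forall p, p \in l -> p.@[v] = 0) -> forall p, S p -> p.@[v] = 0.
Proof.
apply: contrapT => nl.
have next (l : seq {mpoly K[n]}) : exists pv : {mpoly K[n]} * ('I_n -> K),
    (forall p, p \in l -> S p) ->
    [/\ S pv.1, forall p, p \in l -> p.@[pv.2] = 0 & pv.1.@[pv.2] != 0].
  have [lS|nlS] := pselect (forall p, p \in l -> S p); last by exists (0, fun=> 0).
  apply: contrapT => nv; apply: nl; exists l => // v lv p Sp.
  by apply/eqP/negPn/negP => pv; apply: nv; exists (p, v).
have [F FP] := choice next.
pose L k := iter k (fun l => rcons l (F l).1) [::].
have LS k p : p \in L k -> S p.
  elim: k p => // k IH p; rewrite [L _]/= mem_rcons inE => /predU1P[->|/IH //].
  by have [] := FP _ IH.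
have LE k : L k = mkseq (fun k => (F (L k)).1) k.
  by elim: k => // k IH; rewrite mkseqS -IH.
have [k sk] := noetherian_seq (fun k => (F (L k)).1) (@noetherian_mpoly K n).
rewrite -LE in sk; have [_ Fv] := FP _ (LS k); rewrite -/(F _) => /eqP; apply.
exact: meval_spanned sk.
Qed.

(** At a strict step take a form that vanishes on [Z k.+1] but not at some point of [Z k]. The forms
    of all earlier steps vanish at this point, so the new one is not in their span. *)
Lemma zclosed_dcc X (Z : nat -> X -> Prop) :
  (forall k, zclosed (Z k)) -> (forall k x, Z k.+1 x -> Z k x) ->
  exists k, forall x, Z k x -> Z k.+1 x.
Proof.
move=> Zc Zd; apply: contrapT => /forallNP nk.
have Zm j k x : (j <= k)%N -> Z k x -> Z j x.
  move=> /subnK <-; elim: (k - j)%N => // i IH; rewrite addSn => /Zd; exact: IH.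
have sep k : exists px : {mpoly K[hdim (pstr X)]} * X,
    [/\ forall x, Z k.+1 x -> px.1.@[hc x] = 0, Z k px.2 & px.1.@[hc px.2] != 0].
  have /existsNP[x /not_implyP[Zx nZx]] := nk k.
  have [S [homS HS]] := Zc k.+1; apply: contrapT => nS; apply: nZx; apply/HS => p Sp.
  apply/eqP/negPn/negP => px; apply: nS; exists (p, x); split=> // x' /HS; exact.
have [F FP] := choice sep.
have [k sk] := noetherian_seq (fun k => (F k).1) (@noetherian_mpoly K _).
have [_ Zk /eqP] := FP k; apply; apply: meval_spanned sk.
move=> y; rewrite /mkseq => /mapP[j]; rewrite mem_iota => /= jk ->.
by have [Fj _ _] := FP j; apply: Fj; apply: Zm Zk.
Qed.

(** Distinct points of [Z], each with a polynomial isolating it, give a sequence in which no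
    polynomial is in the span of the earlier ones: those all vanish at the new point. *)
Lemma isolated_finite X (Z : X -> Prop) :
  (forall x, Z x -> exists2 p : {mpoly K[hdim (pstr X)]}, p.@[hc x] != 0 &
     forall y, Z y -> p.@[hc y] != 0 -> y = x) ->
  exists s : seq X, forall x, Z x -> x \in s.
Proof.
move=> iso; apply: contrapT => /forallNP ns.
have next (s : seq X) : exists xp : X * {mpoly K[hdim (pstr X)]},
    [/\ Z xp.1, xp.1 \notin s, xp.2.@[hc xp.1] != 0 &
        forall y, Z y -> xp.2.@[hc y] != 0 -> y = xp.1].
  have /existsNP[x /not_implyP[Zx /negP xs]] := ns s.
  by have [p px pZ] := iso x Zx; exists (x, p).
have [F FP] := choice next.
pose L k := iter k (fun s => rcons s (F s).1) [::].
have [k sk] := noetherian_seq (fun k => (F (L k)).2) (@noetherian_mpoly K _).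
have [Zk nk /eqP nz _] := FP (L k); apply: nz; apply: meval_spanned sk.
move=> y; rewrite /mkseq => /mapP[j]; rewrite mem_iota => /= jk ->.
have [_ _ _ Fj] := FP (L j); apply/eqP/negPn/negP => nz'.
move: nk; rewrite (Fj _ Zk nz') => /negP; apply.
elim: k jk {Zk nz'} => // k IH; rewrite ltnS leq_eqVlt [L _]/= mem_rcons inE.
by case/predU1P=> [->|/IH ->]; rewrite ?eqxx ?orbT.
Qed.

End Regular.

(** * Local rings *)

Section Germs.
Variable K : closedFieldType.
Implicit Types X Y : variety K.

Definition znear X (x : X) (P : X -> Prop) : Prop :=
  exists d, exists H : {mpoly K[hdim (pstr X)]},
    [/\ H \is d.-homog, H.@[hc x] != 0 & forall y, H.@[hc y] != 0 -> P y].

(** A germ at [x] is represented by a total function whose values away from the principal open set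
    [H != 0] are arbitrary. *)
Definition regular_at X (x : X) (f : X -> K) : Prop :=
  exists d, exists F H : {mpoly K[hdim (pstr X)]},
    [/\ F \is d.-homog, H \is d.-homog, H.@[hc x] != 0 &
        forall y, H.@[hc y] != 0 -> f y = F.@[hc y] / H.@[hc y]].

Lemma znear_all X (x : X) (P : X -> Prop) : (forall y, P y) -> znear x P.
Proof.
by move=> PT; exists 0%N, 1; rewrite dhomog1 meval1 oner_neq0; split.
Qed.

Lemma znear_imp X (x : X) (P Q : X -> Prop) :
  (forall y, P y -> Q y) -> znear x P -> znear x Q.
Proof. by move=> PQ [d [H [hH Hx HP]]]; exists d, H; split=> // y /HP/PQ. Qed.

Lemma znear_and X (x : X) (P Q : X -> Prop) :
  znear x P -> znear x Q -> znear x (fun y => P y /\ Q y).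
Proof.
move=> [d [H [hH Hx HP]]] [e [L [hL Lx LQ]]]; exists (d + e)%N, (H * L); split.
- exact: dhomogM.
- by rewrite mevalM mulf_neq0.
- by move=> y; rewrite mevalM mulf_eq0 negb_or => /andP[/HP ? /LQ].
Qed.

Lemma znear_forall X (x : X) (T : finType) (P : T -> X -> Prop) :
  (forall i, znear x (P i)) -> znear x (fun y => forall i, P i y).
Proof.
move=> nP; apply: (@znear_imp _ _ (fun y => forall i, i \in enum T -> P i y)).
  by move=> y Py i; apply: Py; rewrite mem_enum.
elim: (enum T) => [|i r IH]; first exact: znear_all.
apply: znear_imp (znear_and (nP i) IH) => y [Pi Pr] j.
by rewrite inE => /predU1P[->|/Pr].
Qed.

Lemma znear_comp X Y (f : X -> Y) (x : X) P :
  regular f -> znear (f x) P -> znear x (fun y => P (f y)).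
Proof.
move=> rf [e [H [hH Hx HP]]]; have [d [F [hF [j Fj] Fp]]] := rf x.
have HE y : (F j).@[hc y] != 0 ->
    H.@[hc (f y)] != 0 = ((subst H F).@[hc y] != 0).
  move=> Fy; rewrite meval_subst; have [|c c0 E] := Fp y; first by exists j.
  by rewrite (homog_scale hH E) mulf_eq0 expf_eq0 (negPf c0) andbF.
(* The factor [F j] restricts to the open set where the local representation of [f] is valid. *)
exists (d + d * e)%N, (F j * subst H F); split.
- by apply: dhomogM => //; apply: homog_subst.
- by rewrite mevalM mulf_neq0 // -HE.
- move=> y; rewrite mevalM mulf_eq0 negb_or => /andP[Fy Hy].
  by apply: HP; rewrite HE.
Qed.

Lemma regular_at_near X (x : X) (f g : X -> K) :
  znear x (fun y => f y = g y) -> regular_at x f -> regular_at x g.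
Proof.
move=> [e [L [hL Lx Lfg]]] [d [F [H [hF hH Hx HE]]]].
exists (d + e)%N, (F * L), (H * L); split; try exact: dhomogM.
  by rewrite mevalM mulf_neq0.
move=> y; rewrite !mevalM mulf_eq0 negb_or => /andP[Hy Ly].
by rewrite -Lfg // HE // -mulf_div divff // mulr1.
Qed.

Lemma regular_at_ext X (x : X) (f g : X -> K) :
  (forall y, f y = g y) -> regular_at x f -> regular_at x g.
Proof. by move=> fg; apply: regular_at_near; apply: znear_all. Qed.

Lemma regular_at_const X (x : X) c : regular_at x (fun=> c).
Proof.
exists 0%N, c%:MP, 1; rewrite dhomog1 meval1 oner_neq0; split=> //.
  by rewrite -[X in X \is _]alg_mpolyC; apply: rpredZ; exact: dhomog1.
by move=> y _; rewrite mevalC meval1 divr1.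
Qed.

Lemma regular_atD X (x : X) f g :
  regular_at x f -> regular_at x g -> regular_at x (fun y => f y + g y).
Proof.
move=> [d [F [H [hF hH Hx HE]]]] [e [G [L [hG hL Lx LE]]]].
exists (d + e)%N, (F * L + G * H), (H * L); split.
- by apply: rpredD; [|rewrite addnC]; apply: dhomogM.
- exact: dhomogM.
- by rewrite mevalM mulf_neq0.
- move=> y; rewrite mevalD !mevalM mulf_eq0 negb_or => /andP[Hy Ly].
  by rewrite HE // LE // addf_div.
Qed.

Lemma regular_atM X (x : X) f g :
  regular_at x f -> regular_at x g -> regular_at x (fun y => f y * g y).
Proof.
move=> [d [F [H [hF hH Hx HE]]]] [e [G [L [hG hL Lx LE]]]].
exists (d + e)%N, (F * G), (H * L); split; try exact: dhomogM.
- by rewrite mevalM mulf_neq0.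
- move=> y; rewrite !mevalM mulf_eq0 negb_or => /andP[Hy Ly].
  by rewrite HE // LE // mulf_div.
Qed.

Lemma regular_atN X (x : X) f : regular_at x f -> regular_at x (fun y => - f y).
Proof.
move=> rf; apply: regular_at_ext (regular_atM (regular_at_const x (-1)) rf).
by move=> y; rewrite mulN1r.
Qed.

Lemma regular_at_sum X (x : X) (T : Type) (r : seq T) (F : T -> X -> K) :
  (forall i, regular_at x (F i)) -> regular_at x (fun y => \sum_(i <- r) F i y).
Proof.
move=> rF; elim: r => [|i r IH].
  by apply: regular_at_ext (regular_at_const x 0) => y; rewrite big_nil.
by apply: regular_at_ext (regular_atD (rF i) IH) => y; rewrite big_cons.
Qed.

Lemma regular_at_prod X (x : X) (T : Type) (r : seq T) (F : T -> X -> K) :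
  (forall i, regular_at x (F i)) -> regular_at x (fun y => \prod_(i <- r) F i y).
Proof.
move=> rF; elim: r => [|i r IH].
  by apply: regular_at_ext (regular_at_const x 1) => y; rewrite big_nil.
by apply: regular_at_ext (regular_atM (rF i) IH) => y; rewrite big_cons.
Qed.

Lemma regular_at_neq0 X (x : X) f :
  regular_at x f -> f x != 0 -> znear x (fun y => f y != 0).
Proof.
move=> [d [F [H [hF hH Hx HE]]]] fx; exists (d + d)%N, (F * H); split.
- exact: dhomogM.
- move: fx; rewrite HE // mevalM mulf_eq0 negb_or => /andP[Fx _].
  by rewrite mulf_neq0.
- move=> y; rewrite mevalM mulf_eq0 negb_or => /andP[Fy Hy].
  by rewrite HE // mulf_neq0 // invr_eq0.
Qed.

Lemma regular_atV X (x : X) f :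
  regular_at x f -> f x != 0 -> regular_at x (fun y => (f y)^-1).
Proof.
move=> [d [F [H [hF hH Hx HE]]]] fx.
exists (d + d)%N, (H * H), (F * H); split; try exact: dhomogM.
- move: fx; rewrite HE // mevalM mulf_eq0 negb_or => /andP[Fx _].
  by rewrite mulf_neq0.
- move=> y; rewrite !mevalM mulf_eq0 negb_or => /andP[Fy Hy].
  by rewrite HE // invf_div -mulf_div divff // mulr1.
Qed.

Lemma regular_at_comp X Y (f : X -> Y) (x : X) g :
  regular f -> regular_at (f x) g -> regular_at x (fun y => g (f y)).
Proof.
move=> rf [e [G [H [hG hH Hx HE]]]]; have [d [F [hF [j Fj] Fp]]] := rf x.
have chart y : (F j).@[hc y] != 0 -> exists2 c, c != 0 &
    forall p, p \is e.-homog -> p.@[hc (f y)] = c * (subst p F).@[hc y].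
  move=> Fy; have [|c c0 E] := Fp y; first by exists j.
  exists (c ^+ e) => [|p hp]; first by rewrite expf_neq0.
  by rewrite meval_subst (homog_scale hp E).
exists (d + d * e)%N, (F j * subst G F), (F j * subst H F); split.
- by apply: dhomogM => //; apply: homog_subst.
- by apply: dhomogM => //; apply: homog_subst.
- have [c c0 cE] := chart x Fj; move: Hx; rewrite cE // mulf_eq0 negb_or.
  by case/andP=> _ Hx; rewrite mevalM mulf_neq0.
- move=> y; rewrite !mevalM mulf_eq0 negb_or => /andP[Fy Hy].
  have [c c0 cE] := chart y Fy; rewrite HE; last by rewrite cE // mulf_neq0.
  by rewrite !cE // -!mulf_div !divff // mulr1 mul1r.
Qed.

(* Affine coordinates in the chart i0; outside the chart they are all 0, since
   x / 0 = 0. *)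
Definition acoord X (i0 : 'I_(hdim (pstr X))) (x : X) j := hc x j / hc x i0.

Lemma regular_at_acoord X (i0 : 'I_(hdim (pstr X))) (x : X) j :
  hc x i0 != 0 -> regular_at x (fun y => acoord i0 y j).
Proof.
move=> xi; exists 1%N, 'X_j, 'X_i0; rewrite !homogU mevalXU; split=> // y.
by rewrite !mevalXU.
Qed.

Lemma regular_at_poly X (i0 : 'I_(hdim (pstr X))) (x : X) p :
  hc x i0 != 0 -> regular_at x (fun y => p.@[acoord i0 y]).
Proof.
move=> xi; elim/mpolyind: p => [|c m p _ _ IH].
  by apply: regular_at_ext (regular_at_const x 0) => y; rewrite meval0.
apply: (@regular_at_ext _ _
  (fun y => c * \prod_i \prod_(k < m i) acoord i0 y i + p.@[acoord i0 y])).
  move=> y; rewrite mevalD mevalZ mevalX; congr (_ * _ + _).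
  by apply: eq_bigr => i _; rewrite prodr_const card_ord.
apply: regular_atD IH; apply: regular_atM; first exact: regular_at_const.
apply: regular_at_prod => i; apply: regular_at_prod => k.
exact: regular_at_acoord.
Qed.

(** Since the [Q j] are polynomials and not constants, the expansion is exact and has no remainder.
    The polynomials admitting one contain the constants and variables and are closed under sums and
    products. *)
Lemma mpoly_first_order n (a : 'I_n -> K) (p : {mpoly K[n]}) :
  exists Q : 'I_n -> {mpoly K[n]},
    forall v, p.@[v] = p.@[a] + \sum_j (Q j).@[v] * (v j - a j).
Proof.
pose T (p : {mpoly K[n]}) := exists Q : 'I_n -> {mpoly K[n]},
  forall v, p.@[v] = p.@[a] + \sum_j (Q j).@[v] * (v j - a j).
have TC c : T c%:MP.
  exists (fun=> 0) => v; rewrite !mevalC big1 ?addr0 // => j _.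
  by rewrite mul0r.
have TD q r : T q -> T r -> T (q + r).
  move=> [Q QE] [S SE]; exists (fun j => Q j + S j) => v.
  rewrite !mevalD QE SE addrACA -big_split /=; congr (_ + _).
  by apply: eq_bigr => j _; rewrite mevalD mulrDl.
have TM q r : T q -> T r -> T (q * r).
  move=> [Q QE] [S SE]; exists (fun j => r * Q j + q.@[a] *: S j) => v.
  rewrite !mevalM [in LHS]QE mulrDl {1}SE mulrDr -addrA; congr (_ + _).
  rewrite mulr_sumr mulr_suml -big_split /=; apply: eq_bigr => j _.
  by rewrite mevalD mevalM mevalZ; ring.
have TX j : T 'X_j.
  exists (fun i => (i == j)%:R) => v; rewrite !mevalXU (bigD1 j) //= eqxx meval1.
  rewrite big1 ?addr0; first by rewrite mul1r addrC subrK.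
  by move=> i /negPf ->; rewrite mulr0n meval0 mul0r.
elim/mpolyind: p => [|c m p _ _ IH]; first exact: (TC 0).
apply: (TD) => //; rewrite -mul_mpolyC; apply: (TM) => //; rewrite mpolyXE_id.
apply: (big_ind T) => [||i _]; [exact: (TC 1)|exact: TM|].
by elim: (m i) => [|k IHk]; [exact: (TC 1)|rewrite exprS; apply: TM].
Qed.

Lemma regular_at_first_order X (i0 : 'I_(hdim (pstr X))) (x : X) f :
  hc x i0 != 0 -> regular_at x f ->
  exists2 c : 'I_(hdim (pstr X)) -> X -> K, forall j, regular_at x (c j) &
    znear x (fun y =>
      f y = f x + \sum_j c j y * (acoord i0 y j - acoord i0 x j)).
Proof.
move=> xi [d [F [H [hF hH Hx HE]]]].
have chart p y : p \is d.-homog -> hc y i0 != 0 ->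
    p.@[hc y] = hc y i0 ^+ d * p.@[acoord i0 y].
  by move=> hp yi; apply: homog_scale => // j; rewrite mulrC divfK.
have H0 y : H.@[hc y] != 0 -> hc y i0 != 0 -> H.@[acoord i0 y] != 0.
  by move=> Hy yi; move: Hy; rewrite chart // mulf_eq0 negb_or => /andP[].
have fE y : H.@[hc y] != 0 -> hc y i0 != 0 ->
    f y = F.@[acoord i0 y] / H.@[acoord i0 y].
  move=> Hy yi; rewrite HE // !chart // -mulf_div divff ?mul1r //.
  by rewrite expf_neq0.
(* In affine coordinates [f y - f x] is [G] divided by [D y], and [G] vanishes at [x]. *)
pose G := H.@[acoord i0 x] *: F - F.@[acoord i0 x] *: H.
have [Q QE] := mpoly_first_order (acoord i0 x) G.
pose D y := H.@[acoord i0 y] * H.@[acoord i0 x].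
exists (fun j y => (Q j).@[acoord i0 y] / D y) => [j|].
  apply: regular_atM; first exact: regular_at_poly.
  apply: regular_atV; last by rewrite mulf_neq0 ?H0.
  by apply: regular_atM; [exact: regular_at_poly|exact: regular_at_const].
exists (d + 1)%N, (H * 'X_i0); split.
- by apply: dhomogM => //; exact: homogU.
- by rewrite mevalM mevalXU mulf_neq0.
- move=> y; rewrite mevalM mevalXU mulf_eq0 negb_or => /andP[Hy yi].
  have Hy' := H0 _ Hy yi; have Hx' := H0 _ Hx xi; rewrite !fE //.
  under eq_bigr => j _ do rewrite mulrAC.
  rewrite -mulr_suml; have := QE (acoord i0 y).
  have -> : G.@[acoord i0 x] = 0 by rewrite mevalB !mevalZ mulrC subrr.
  rewrite add0r => <-; rewrite mevalB !mevalZ /D; field.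
  by rewrite Hx'.
Qed.

End Germs.

(** * Finiteness of torsion *)

Section FiniteTorsion.
Variable K : closedFieldType.
Variable A : abelian_variety K.
Local Notation V := (abvar A).
Local Notation VV := (prodv V V).

Lemma regular_addf (X : variety K) (f g : X -> A) :
  @regular _ X V f -> @regular _ X V g -> @regular _ X V (fun x => f x + g x).
Proof.
move=> rf rg; exact: (@regular_comp _ X VV V (fun x => (f x, g x))
  (fun z => z.1 + z.2) (@regular_pair _ V V X f g rf rg) (@ab_add_regular _ A)).
Qed.

Lemma regular_oppf (X : variety K) (f : X -> A) :
  @regular _ X V f -> @regular _ X V (fun x => - f x).
Proof. by move=> rf; exact: (regular_comp rf (@ab_opp_regular _ A)). Qed.

Lemma regular_subf (X : variety K) (f g : X -> A) :
  @regular _ X V f -> @regular _ X V g -> @regular _ X V (fun x => f x - g x).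
Proof. by move=> rf rg; apply: regular_addf => //; apply: regular_oppf. Qed.

Lemma regular_sumf (X : variety K) (T : Type) (r : seq T) (F : T -> X -> A) :
  (forall i, @regular _ X V (F i)) ->
  @regular _ X V (fun x => \sum_(i <- r) F i x).
Proof.
move=> rF; elim: r => [|i r IH].
  have -> : (fun x => \sum_(i <- [::]) F i x) = (fun=> 0).
    by apply/funext => x; rewrite big_nil.
  exact: regular_const.
have -> : (fun x => \sum_(j <- i :: r) F j x)
    = (fun x => F i x + \sum_(j <- r) F j x).
  by apply/funext => x; rewrite big_cons.
exact: regular_addf.
Qed.

Lemma regular_mulrnf (X : variety K) (f : X -> A) n :
  @regular _ X V f -> @regular _ X V (fun x => f x *+ n).
Proof.
move=> rf; have -> : (fun x => f x *+ n) = (fun x => \sum_(i <- iota 0 n) f x).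
  by apply/funext => x; rewrite big_const_seq count_predT size_iota iter_addr_0.
exact: regular_sumf.
Qed.

Section LocalMultiplication.
Variables (i0 : 'I_(hdim (pstr V))) (hi0 : hc (0 : V) i0 != 0).

Definition lcoord (x : V) j := acoord i0 x j - acoord i0 (0 : V) j.

Lemma regular_at_lcoord j : regular_at (0 : V) (lcoord^~ j).
Proof.
apply: regular_atD; first exact: regular_at_acoord.
exact: regular_at_const.
Qed.

Lemma lcoord0 j : lcoord 0 j = 0. Proof. exact: subrr. Qed.

Lemma add_first_order i : exists a b : 'I_(hdim (pstr V)) -> VV -> K,
  [/\ forall j, regular_at ((0, 0) : VV) (a j),
      forall j, regular_at ((0, 0) : VV) (b j) &
      znear ((0, 0) : VV) (fun z => lcoord (z.1 + z.2) i =
        \sum_j a j z * lcoord z.1 j + \sum_j b j z * lcoord z.2 j)].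
Proof.
pose I0 : 'I_(hdim (pstr VV)) := mxvec_index i0 i0.
have hI0 : hc ((0, 0) : VV) I0 != 0 by rewrite /hc /= segreE mulf_neq0.
have rs : regular_at ((0, 0) : VV) (fun z => lcoord (z.1 + z.2) i).
  apply: (@regular_at_comp _ VV V (fun z => z.1 + z.2) (0, 0) (lcoord^~ i)).
    exact: ab_add_regular.
  by rewrite /= addr0; exact: regular_at_lcoord.
have [c rc cE] := regular_at_first_order hI0 rs.
have racoord j : regular_at ((0, 0) : VV) (fun z => acoord i0 (z.2 : V) j).
  apply: (@regular_at_comp _ VV V snd (0, 0) (acoord i0 ^~ j)).
    exact: regular_snd.
  exact: regular_at_acoord.
(* In the Segre chart the coordinates of (x, y) are products x_j y_k, and x_j y_k - o_j o_k = (x_j -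
   o_j) y_k + o_j (y_k - o_k), where o is the point 0. *)
exists (fun j z => \sum_k c (mxvec_index j k) z * acoord i0 (z.2 : V) k).
exists (fun k z => \sum_j c (mxvec_index j k) z * acoord i0 (0 : V) j).
split=> [j|k|].
- by apply: regular_at_sum => k; apply: regular_atM.
- by apply: regular_at_sum => j; apply: regular_atM => //; exact: regular_at_const.
apply: znear_imp cE => -[x y] /= ->; rewrite addr0 lcoord0 add0r.
pose F k := c k (x, y) * (acoord I0 ((x, y) : VV) k - acoord I0 ((0, 0) : VV) k).
rewrite -/(F _).
have -> : \sum_k F k = \sum_j \sum_k F (mxvec_index j k).
  rewrite pair_bigA (reindex _ (curry_mxvec_bij _ _)).
  by apply: eq_bigr => -[j k].
rewrite {}/F.
under [X in _ + X]eq_bigr => k _ do rewrite mulr_suml.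
rewrite [X in _ + X]exchange_big -big_split /=; apply: eq_bigr => j _.
rewrite mulr_suml -big_split /=; apply: eq_bigr => k _.
have aE (u v : V) j' k' : acoord I0 ((u, v) : VV) (mxvec_index j' k')
    = acoord i0 u j' * acoord i0 v k'.
  by rewrite /acoord /hc /= !segreE mulf_div.
by rewrite !aE /lcoord; ring.
Qed.

(** The affine coordinates can satisfy relations on A, so the coefficients in [add_first_order] are
    not unique and need not be the identity at (0, 0). The expansion at (x, n x) is therefore
    compared with those at (x, 0) and (0, n x), whose left sides are the coordinates of x and of n
    x. What remains beyond the sum of these two has coefficients that are differences vanishing at x
    = 0. *)
Lemma mul_first_order n :
  exists2 M : 'I_(hdim (pstr V)) -> 'I_(hdim (pstr V)) -> V -> K,
    forall i j, regular_at (0 : V) (M i j) /\ M i j 0 = n%:R *+ (i == j) &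
    forall i, znear (0 : V) (fun x => lcoord (x *+ n) i = \sum_j M i j x * lcoord x j).
Proof.
elim: n => [|n [M MP ME]].
  exists (fun _ _ _ => 0) => [i j|i].
    by rewrite mul0rn; split=> //; exact: regular_at_const.
  by apply: znear_all => x; rewrite big1 ?lcoord0 // => j _; rewrite mul0r.
pose ab i (p : ('I_(hdim (pstr V)) -> VV -> K) * ('I_(hdim (pstr V)) -> VV -> K)) :=
  [/\ forall j, regular_at ((0, 0) : VV) (p.1 j),
      forall j, regular_at ((0, 0) : VV) (p.2 j) &
      znear ((0, 0) : VV) (fun z => lcoord (z.1 + z.2) i =
        \sum_j p.1 j z * lcoord z.1 j + \sum_j p.2 j z * lcoord z.2 j)].
have /choice[p pP] i : exists p, ab i p.
  by have [a [b abP]] := add_first_order i; exists (a, b).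
pose g (x : V) : VV := (x, x *+ n).
pose g1 (x : V) : VV := (x, 0).
pose g2 (x : V) : VV := (0, x *+ n).
have rid := @regular_id _ V.
have rg : regular g by apply: (@regular_pair _ V V V) => //; exact: regular_mulrnf.
have rg1 : regular g1 by apply: (@regular_pair _ V V V) => //; exact: regular_const.
have rg2 : regular g2.
  by apply: (@regular_pair _ V V V); [exact: regular_const|exact: regular_mulrnf].
have g0 : g 0 = (0, 0) by rewrite /g mul0rn.
have g20 : g2 0 = (0, 0) by rewrite /g2 mul0rn.
have rc (h : V -> VV) f : regular h -> h 0 = (0, 0) ->
    regular_at ((0, 0) : VV) f -> regular_at (0 : V) (f \o h).
  by move=> rh h0 rf; apply: regular_at_comp => //; rewrite h0.
pose N i j (x : V) := (i == j)%:R + M i j x + ((p i).1 j (g x) - (p i).1 j (g1 x))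
  + \sum_k ((p i).2 k (g x) - (p i).2 k (g2 x)) * M k j x.
exists N => [i j|i].
  have [ra rb _] := pP i; split.
    apply: regular_atD; first apply: regular_atD.
    - by apply: regular_atD; [exact: regular_at_const|have [] := MP i j].
    - apply: regular_atD; first exact: (rc g).
      by apply: regular_atN; exact: (rc g1).
    - apply: regular_at_sum => k; apply: regular_atM; last by have [] := MP k j.
      apply: regular_atD; first exact: (rc g).
      by apply: regular_atN; exact: (rc g2).
  rewrite /N g0 g20 subrr big1 => [|k _]; last by rewrite subrr mul0r.
  by rewrite !addr0; have [_ ->] := MP i j; rewrite -mulrnDl -mulrS.
have [_ _ nab] := pP i.
have nabc (h : V -> VV) : regular h -> h 0 = (0, 0) ->
    znear (0 : V) (fun x => lcoord ((h x).1 + (h x).2) i =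
      \sum_j (p i).1 j (h x) * lcoord (h x).1 j
      + \sum_j (p i).2 j (h x) * lcoord (h x).2 j).
  by move=> rh h0; rewrite -h0 in nab; exact: (znear_comp rh nab).
apply: znear_imp (znear_and (znear_and (nabc g rg g0) (nabc g1 rg1 (erefl _)))
  (znear_and (nabc g2 rg2 g20) (znear_forall ME))) => x [[Eg Eg1] [Eg2 EM]].
move: Eg1 Eg2 Eg; rewrite /= addr0 add0r -mulrS => Eg1 Eg2 ->.
rewrite [X in _ + X]big1 ?addr0 in Eg1; last by move=> j _; rewrite lcoord0 mulr0.
rewrite [X in X + _]big1 ?add0r in Eg2; last by move=> j _; rewrite lcoord0 mulr0.
have -> : \sum_j N i j x * lcoord x j =
    lcoord x i + lcoord (x *+ n) i
    + \sum_j ((p i).1 j (g x) - (p i).1 j (g1 x)) * lcoord x j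
    + \sum_k ((p i).2 k (g x) - (p i).2 k (g2 x)) * lcoord (x *+ n) k.
  have -> : lcoord x i = \sum_j (i == j)%:R * lcoord x j.
    rewrite (bigD1 i) //= eqxx mul1r big1 ?addr0 // => j.
    by rewrite eq_sym => /negPf ->; rewrite mul0r.
  rewrite EM; under [X in _ = _ + X]eq_bigr => k _ do rewrite EM mulr_sumr.
  rewrite [X in _ = _ + X]exchange_big -!big_split /=; apply: eq_bigr => j _.
  rewrite /N [LHS]mulrDl [X in X + _ = _]mulrDl [X in X + _ + _ = _]mulrDl.
  congr (_ + _ + _ + _).
  by rewrite mulr_suml; apply: eq_bigr => k _; rewrite mulrA.
rewrite {1}Eg1 {1}Eg2 -addrA addrACA; congr (_ + _); rewrite -big_split /=.
  by apply: eq_bigr => j _; rewrite mulrBl addrC subrK.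
by apply: eq_bigr => j _; rewrite mulrBl addrC subrK.
Qed.

(* The differential of [n] at 0 is the invertible scalar n. *)
Lemma torsion_isolated0 n : n%:R != 0 :> K ->
  znear (0 : V) (fun x => x *+ n = 0 -> x = 0).
Proof.
move=> n0; have [M MP ME] := mul_first_order n.
pose D (x : V) := \det (\matrix_(i, j) M i j x).
have DE x : D x = \sum_(s : 'S_(hdim (pstr V)))
    (-1) ^+ s * \prod_i M i (s i) x.
  by apply: eq_bigr => s _; congr (_ * _); apply: eq_bigr => i _; rewrite mxE.
have rD : regular_at (0 : V) D.
  apply: regular_at_ext (fun x => esym (DE x)) _.
  apply: regular_at_sum => s; apply: regular_atM; first exact: regular_at_const.
  by apply: regular_at_prod => i; have [] := MP i (s i).
have D0 : D 0 != 0.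
  rewrite /D; have -> : \matrix_(i, j) M i j 0 = n%:R%:M.
    by apply/matrixP => i j; rewrite !mxE; have [_ ->] := MP i j.
  by rewrite det_scalar expf_neq0.
(* Only inside the chart do the affine coordinates determine the point. *)
have n_i0 : znear (0 : V) (fun x => hc x i0 != 0).
  by exists 1%N, 'X_i0; rewrite homogU mevalXU; split=> // y; rewrite mevalXU.
apply: znear_imp (znear_and (znear_and (regular_at_neq0 rD D0) n_i0) (znear_forall ME)).
move=> x [[Dx xi] Ex] nx0.
have : (\matrix_(i, j) M i j x) *m (\col_j lcoord x j) = 0.
  apply/matrixP => i j; rewrite !mxE -[RHS](lcoord0 i) -nx0 Ex.
  by apply: eq_bigr => k _; rewrite !mxE.
(* Cramer's rule turns the system into [D x * lcoord x j = 0] for every [j], with [D x] nonzero. *)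
move/(congr1 (mulmx (\adj (\matrix_(i, j) M i j x)))).
rewrite mulmxA mul_adj_mx mulmx0 mul_scalar_mx => /matrixP E.
apply: (@hcoord_inj _ _ (pstr V)); exists (hc x i0 / hc (0 : V) i0).
  by rewrite mulf_neq0 // invr_eq0.
move=> j; have /eqP := E j 0; rewrite !mxE mulf_eq0 -/(D x) (negPf Dx) /=.
rewrite subr_eq0 => /eqP Ej; rewrite mulrAC -mulrA -/(acoord i0 (0 : V) j) -Ej.
by rewrite /acoord mulrCA divff // mulr1.
Qed.

End LocalMultiplication.

(** Subtracting a torsion point [x] preserves n-torsion and carries [x] to 0, so [x] is isolated
    because 0 is. *)
Lemma torsion_finite n : n%:R != 0 :> K ->
  exists s : seq A, forall x : A, x *+ n = 0 -> x \in s.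
Proof.
move=> n0; apply: (@isolated_finite _ V (fun x => x *+ n = 0)) => x nx.
have [i0 hi0] := hc_nonzero (0 : V).
have := torsion_isolated0 hi0 n0; rewrite -{1}(subrr (x : A)) => nz.
have rsub : @regular _ V V (fun y => y - x).
  by apply: regular_subf; [exact: regular_id|exact: regular_const].
have [d [H [_ Hx HP]]] := znear_comp rsub nz.
exists H => // y ny Hy; apply/eqP; rewrite -subr_eq0; apply/eqP.
by apply: HP => //; rewrite mulrnBl nx ny subrr.
Qed.

End FiniteTorsion.

(** * Images of homomorphisms and divisibility *)

Section Chevalley.
Variable K : closedFieldType.

(** [rformula] excludes inversion, so that after quantifier elimination the atoms are polynomial
    equations. *)
Definition definable (P : seq K -> Prop) : Prop :=
  exists2 f : GRing.formula K, GRing.rformula f &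
    forall e, GRing.holds e f <-> P e.

Lemma definable_and P Q :
  definable P -> definable Q -> definable (fun e => P e /\ Q e).
Proof.
move=> [f rf fP] [g rg gQ]; exists (GRing.And f g) => [|e] /=; first by rewrite rf.
by rewrite fP gQ.
Qed.

Lemma definable_not P : definable P -> definable (fun e => ~ P e).
Proof. by move=> [f rf fP]; exists (GRing.Not f) => [|e] //=; rewrite fP. Qed.

Lemma definable_all (T : eqType) (r : seq T) (P : T -> seq K -> Prop) :
  (forall x, definable (P x)) -> definable (fun e => forall x, x \in r -> P x e).
Proof.
move=> dP; elim: r => [|x r IH]; first by exists (GRing.Bool true).
have [f rf fP] := definable_and (dP x) IH; exists f => // e; rewrite fP.
split=> [[Px Pr] y|Pr]; first by rewrite inE => /predU1P[->|/Pr].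
by split=> [|y yr]; apply: Pr; rewrite inE ?eqxx ?yr ?orbT.
Qed.

Definition polynomial_fun (g : seq K -> K) : Prop :=
  exists2 t : GRing.term K, GRing.rterm t & forall e, GRing.eval e t = g e.

Lemma polynomial_funM g h :
  polynomial_fun g -> polynomial_fun h -> polynomial_fun (fun e => g e * h e).
Proof.
move=> [t rt tE] [u ru uE]; exists (GRing.Mul t u) => [|e] /=; first by rewrite rt.
by rewrite tE uE.
Qed.

Lemma polynomial_fun_nth i : polynomial_fun (fun e => e`_i).
Proof. by exists (GRing.Var K i). Qed.

Lemma polynomial_fun_meval n (p : {mpoly K[n]}) k :
  polynomial_fun (fun e => p.@[fun i => e`_(k + i)]).
Proof.
elim/mpolyind: p => [|c m p _ _ [t rt tE]].
  by exists (GRing.Const 0) => // e; rewrite meval0.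
have [u ru uE] : polynomial_fun (fun e => \prod_(i < n) e`_(k + i) ^+ m i).
  elim: (index_enum _) => [|i r [u ru uE]].
    by exists (GRing.Const 1) => // e; rewrite big_nil.
  exists (GRing.Mul (GRing.Exp (GRing.Var K (k + i)) (m i)) u) => // e /=.
  by rewrite uE big_cons.
exists (GRing.Add (GRing.Mul (GRing.Const c) u) t) => [|e] /=; first by rewrite ru.
by rewrite mevalD mevalZ mevalX uE tE.
Qed.

Lemma definable_eq g h :
  polynomial_fun g -> polynomial_fun h -> definable (fun e => g e = h e).
Proof.
move=> [t rt tE] [u ru uE]; exists (GRing.Equal t u) => [|e] /=; first by rewrite rt.
by rewrite tE uE.
Qed.

Definition point_seq m (v : 'I_m -> K) : seq K := [seq v i | i <- enum 'I_m].

Lemma size_point_seq m (v : 'I_m -> K) : size (point_seq v) = m.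
Proof. by rewrite size_map size_enum_ord. Qed.

Lemma nth_point_seq m (v : 'I_m -> K) (i : 'I_m) : (point_seq v)`_i = v i.
Proof. by rewrite (nth_map i) ?size_enum_ord // nth_ord_enum. Qed.

Lemma rterm_mpoly m (t : GRing.term K) : GRing.rterm t ->
  exists p : {mpoly K[m]}, forall v, GRing.eval (point_seq v) t = p.@[v].
Proof.
elim: t => //=.
- move=> k _; have [km|mk] := ltnP k m.
    by exists 'X_(Ordinal km) => v; rewrite mevalXU -nth_point_seq.
  (* A variable beyond the length of the sequence evaluates to its default 0. *)
  by exists 0 => v; rewrite meval0 nth_default ?size_point_seq.
- by move=> c _; exists c%:MP => v; rewrite mevalC.
- by move=> k _; exists (k%:R%:MP) => v; rewrite mevalC.
- move=> t1 IH1 t2 IH2 /andP[/IH1[p pE] /IH2[q qE]].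
  by exists (p + q) => v; rewrite mevalD pE qE.
- by move=> t1 IH1 /IH1[p pE]; exists (- p) => v; rewrite mevalN pE.
- by move=> t1 IH1 k /IH1[p pE]; exists (p *+ k) => v; rewrite mevalMn pE.
- move=> t1 IH1 t2 IH2 /andP[/IH1[p pE] /IH2[q qE]].
  by exists (p * q) => v; rewrite mevalM pE qE.
- by move=> t1 IH1 k /IH1[p pE]; exists (p ^+ k) => v; rewrite rmorphXn /= pE.
Qed.

(** A set is constructible exactly when, for some finite [Q], it is a union of classes of this
    equivalence; this replaces Boolean combinations of closed sets. *)
Definition same_zeros m (Q : seq {mpoly K[m]}) (v w : 'I_m -> K) : Prop :=
  forall q, q \in Q -> (q.@[v] == 0) = (q.@[w] == 0).

Lemma qf_same_zeros m (f : GRing.formula K) :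
  GRing.qf_form f -> GRing.rformula f ->
  exists Q : seq {mpoly K[m]}, forall v w, same_zeros Q v w ->
    GRing.qf_eval (point_seq v) f = GRing.qf_eval (point_seq w) f.
Proof.
have cat_l Q1 Q2 v w : @same_zeros m (Q1 ++ Q2) v w -> same_zeros Q1 v w.
  by move=> s q qQ; apply: s; rewrite mem_cat qQ.
have cat_r Q1 Q2 v w : @same_zeros m (Q1 ++ Q2) v w -> same_zeros Q2 v w.
  by move=> s q qQ; apply: s; rewrite mem_cat qQ orbT.
elim: f => //=.
- by exists [::].
- move=> t1 t2 _ /andP[/(rterm_mpoly m)[p pE] /(rterm_mpoly m)[q qE]].
  exists [:: p - q] => v w s; rewrite !pE !qE.
  by have := s (p - q) (mem_head _ _); rewrite !mevalB !subr_eq0.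
- move=> f IHf g IHg /andP[qf qg] /andP[rf rg].
  have [Q1 E1] := IHf qf rf; have [Q2 E2] := IHg qg rg.
  by exists (Q1 ++ Q2) => v w s; rewrite (E1 v w) ?(E2 v w) //; [apply: cat_r s|apply: cat_l s].
- move=> f IHf g IHg /andP[qf qg] /andP[rf rg].
  have [Q1 E1] := IHf qf rf; have [Q2 E2] := IHg qg rg.
  by exists (Q1 ++ Q2) => v w s; rewrite (E1 v w) ?(E2 v w) //; [apply: cat_r s|apply: cat_l s].
- move=> f IHf g IHg /andP[qf qg] /andP[rf rg].
  have [Q1 E1] := IHf qf rf; have [Q2 E2] := IHg qg rg.
  by exists (Q1 ++ Q2) => v w s; rewrite (E1 v w) ?(E2 v w) //; [apply: cat_r s|apply: cat_l s].
- by move=> f IHf qf rf; have [Q QE] := IHf qf rf; exists Q => v w /QE ->.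
Qed.

(* Chevalley's theorem for the image of the locally closed set
   [l = 0, h <> 0] under the rational map Phi / h, by quantifier elimination:
   membership in the image only depends on the vanishing of finitely many
   polynomials. *)
Lemma image_same_zeros n m (l : seq {mpoly K[n]}) (h : {mpoly K[n]})
    (Phi : 'I_m -> {mpoly K[n]}) :
  let T v := exists w, [/\ forall p, p \in l -> p.@[w] = 0, h.@[w] != 0 &
                           forall j, v j * h.@[w] = (Phi j).@[w]] in
  exists Q : seq {mpoly K[m]}, forall v v', same_zeros Q v v' -> T v -> T v'.
Proof.
(* The sequence [e] holds the target point in its first [m] entries and the source point in the next
   [n], which are the quantified ones. *)
move=> T; pose sh (e : seq K) (i : 'I_n) := e`_(m + i).
have [f rf fP] : definable (fun e => (forall p, p \in l -> p.@[sh e] = 0) /\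
    (h.@[sh e] <> 0 /\
     forall j, j \in enum 'I_m -> e`_j * h.@[sh e] = (Phi j).@[sh e])).
  apply: definable_and; [|apply: definable_and].
  - apply: definable_all => p; apply: definable_eq.
      exact: polynomial_fun_meval.
    by exists (GRing.Const 0).
  - apply: definable_not; apply: definable_eq.
      exact: polynomial_fun_meval.
    by exists (GRing.Const 0).
  - apply: definable_all => j; apply: definable_eq.
      apply: polynomial_funM; first exact: polynomial_fun_nth.
      exact: polynomial_fun_meval.
    exact: polynomial_fun_meval.
pose F := foldr (@GRing.Exists K) f (iota m n).
have rF : GRing.rformula F by rewrite /F; elim: (iota m n).
have FT v : GRing.holds (point_seq v) F <-> T v.
  rewrite /F -GRing.foldExistsP; split=> [[e eE /fP[le [he Pe]]]|[w [lw hw Pw]]].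
    exists (sh e); split=> [//||j]; first exact/eqP.
    rewrite -Pe ?mem_enum // -nth_point_seq; congr (_ * _); apply: eE.
    by rewrite inE mem_iota leqNgt ltn_ord.
  have nthw i : (point_seq v ++ point_seq w)`_(m + i) = (point_seq w)`_i.
    by rewrite nth_cat size_point_seq ltnNge leq_addr /= addKn.
  exists (point_seq v ++ point_seq w) => [k|].
    rewrite !inE mem_iota negb_and -ltnNge nth_cat size_point_seq.
    case: ltnP => //= mk; rewrite -leqNgt => nk.
    by rewrite !nth_default ?size_point_seq // leq_subRL.
  have shw p : p.@[sh (point_seq v ++ point_seq w)] = p.@[w].
    by apply: meval_eq => i; rewrite /sh nthw nth_point_seq.
  apply/fP; split=> [p pl|]; first by rewrite shw lw.
  split=> [|j _]; first by rewrite shw; apply/eqP.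
  by rewrite !shw -Pw nth_cat size_point_seq ltn_ord nth_point_seq.
pose ex := @ClosedFieldQE.ex_elim K.
have ok := @ClosedFieldQE.holds_ex_elim K (@GRing.solve_monicpoly K).
have wf := @ClosedFieldQE.wf_ex_elim K.
have /andP[qF rqF] := GRing.quantifier_elim_wf wf rF.
have [Q QE] := qf_same_zeros m qF rqF; exists Q => v v' /QE E /FT.
move/(GRing.quantifier_elim_rformP wf ok _ rF); rewrite E.
by move/(GRing.quantifier_elim_rformP wf ok _ rF)/FT.
Qed.

End Chevalley.

Section ClosedImage.
Variables (K : closedFieldType) (A B : abelian_variety K) (f : A -> B).
Hypothesis f_hom : homomorphism f.

Lemma homB x y : f (x - y) = f x - f y.
Proof.
have [_ fD] := f_hom; apply: (@addIr _ (f y)).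
by rewrite -fD !subrK.
Qed.

Lemma hom0 : f 0 = 0.
Proof. by rewrite -(subrr 0) homB subrr. Qed.

Definition image_closure (b : abvar B) : Prop :=
  forall d p, p \is d.-homog -> (forall x, p.@[hc (f x : abvar B)] = 0) ->
    p.@[hc b] = 0.

Lemma zclosed_image_closure : zclosed image_closure.
Proof.
exists (fun p => (exists d, p \is d.-homog) /\
                 forall x, p.@[hc (f x : abvar B)] = 0).
split=> [p []//|b]; split=> [Zb p [[d hp] pf]|Zb d p hp pf]; first exact: (Zb d).
by apply: Zb; split=> //; exists d.
Qed.

Lemma image_closure_min (W : abvar B -> Prop) : zclosed W ->
  (forall x, W (f x)) -> forall b, image_closure b -> W b.
Proof.
move=> [S [homS HS]] Wf b Zb; apply/HS => p Sp; have [d hp] := homS p Sp.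
by apply: (Zb d) => // x; move/HS: (Wf x); apply.
Qed.

Lemma image_closureB x b : image_closure b -> image_closure (b - f x).
Proof.
apply: (@image_closure_min (fun c => image_closure (c - f x))) => [|y].
  apply: (@zclosed_preimage _ (abvar B) (abvar B) (fun b => b - f x)).
    by apply: regular_subf; [exact: regular_id|exact: regular_const].
  exact: zclosed_image_closure.
by rewrite -homB => d p hp; apply.
Qed.

(** Membership in the image depends on the zeros of a finite list [Q]. Let [Q1] be the part of [Q]
    that does not vanish identically on the image. By irreducibility of A some [x1] has an image
    where no element of [Q1] vanishes. A point of the closure where no element of [Q1] vanishes has
    the same zeros in [Q] as [f x1], and so lies in the image. *)
Lemma image_contains_open : exists d, exists2 g : {mpoly K[hdim (pstr (abvar B))]},
  g \is d.-homog /\ (exists x, g.@[hc (f x : abvar B)] != 0) &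
  forall b, image_closure b -> g.@[hc b] != 0 -> exists x, f x = b.
Proof.
have [rf _] := f_hom; have irA := ab_irreducible A.
have [d [F0 [hF0 [j0 F00] Fp0]]] := rf (0 : abvar A).
have [i0 hi0] := hc_nonzero (0 : abvar A).
(* The extra factor makes [F j0] vanish at the origin even if [F0] has degree 0, so a solution [w]
   with [F j0] nonzero is a nonzero vector and represents a point of A. *)
pose F j := F0 j * 'X_i0.
have hF j : F j \is (d + 1).-homog by apply: dhomogM => //; exact: homogU.
have [S [homS HS]] := hcoord_closed (pstr (abvar A)).
have [l lS lz] := vanishing_finite S.
have [Q QP] := image_same_zeros l (F j0) F.
have Fx (x : A) : (F j0).@[hc (x : abvar A)] != 0 -> hc (f x : abvar B) j0 != 0 /\
    forall j, acoord j0 (f x : abvar B) j * (F j0).@[hc (x : abvar A)]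
              = (F j).@[hc (x : abvar A)].
  rewrite mevalM mulf_eq0 negb_or => /andP[nz xi].
  have [|c c0 E] := Fp0 x; first by exists j0.
  split=> [|j]; first by rewrite E mulf_neq0.
  rewrite /acoord !E !mevalM -mulf_div divff // mul1r mulrA.
  by rewrite divfK.
have /choice[hq hqP] (q : {mpoly K[hdim (pstr (abvar B))]}) :
    exists p : {mpoly K[hdim (pstr (abvar B))]}, (exists e, p \is e.-homog) /\
      forall b : abvar B, hc b j0 != 0 -> (p.@[hc b] == 0) = (q.@[acoord j0 b] == 0).
  have [e [p hp pE]] := homogenize q j0; exists p; split=> [|b bj]; first by exists e.
  by rewrite pE // mulf_eq0 expf_eq0 (negPf bj) andbF.
pose vanish q (x : abvar A) := (hq q).@[hc (f x : abvar B)] = 0.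
(* [None] adds the complement of the chart to the closed sets that the generic point must avoid. *)
pose Z (o : option {mpoly K[hdim (pstr (abvar B))]}) (x : abvar A) :=
  if o is Some q then vanish q x else (F j0).@[hc x] = 0.
pose Q1 := [seq q <- Q | `[< exists x, ~ vanish q x >]].
have [||x1 x1P] := @irreducible_generic _ _ _ (None :: map Some Q1) Z irA.
- case=> [q|] _; last exact: zclosed_form (hF j0).
  have [[e he] _] := hqP q.
  apply: (@zclosed_preimage _ (abvar A) (abvar B) f (fun b => (hq q).@[hc b] = 0)) => //.
  exact: zclosed_form he.
- case=> [q|_]; last by exists 0; apply/eqP; rewrite mevalM mevalXU mulf_neq0.
  by rewrite inE /= mem_map ?mem_filter => [/andP[/asboolP]//|? ? []].
have x1j : (F j0).@[hc (x1 : abvar A)] != 0.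
  by apply/eqP; exact: (x1P None (mem_head _ _)).
have [fx1j fx1E] := Fx _ x1j.
have homg : exists e, ('X_j0 * \prod_(q <- Q1) hq q) \is e.-homog.
  have [e he] : exists e, (\prod_(q <- Q1) hq q) \is e.-homog.
    elim: (Q1) => [|q r [e he]]; first by exists 0%N; rewrite big_nil; exact: dhomog1.
    have [[e' he'] _] := hqP q; exists (e' + e)%N; rewrite big_cons.
    exact: dhomogM.
  by exists (1 + e)%N; apply: dhomogM => //; exact: homogU.
have [e he] := homg.
have gE (b : abvar B) : ('X_j0 * \prod_(q <- Q1) hq q).@[hc b] != 0 ->
    hc b j0 != 0 /\ forall q, q \in Q1 -> (hq q).@[hc b] != 0.
  rewrite mevalM mevalXU mulf_eq0 negb_or => /andP[bj]; rewrite rmorph_prod /=.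
  by rewrite prodf_seq_neq0 => /allP nz; split.
exists e, ('X_j0 * \prod_(q <- Q1) hq q); first split=> //.
  exists x1; rewrite mevalM mevalXU mulf_neq0 // rmorph_prod /=.
  rewrite prodf_seq_neq0; apply/allP => q qQ; apply/eqP; apply: (x1P (Some q)).
  by rewrite inE /= map_f.
move=> b Zb /gE[bj bQ].
have [||w [wl wj wE]] := QP (acoord j0 (f x1 : abvar B)) (acoord j0 b).
- move=> q qQ; have [_ qE] := hqP q; rewrite -!qE //.
  have [qQ1|] := boolP (q \in Q1).
    rewrite (negPf (bQ _ qQ1)); apply/negbTE/eqP; apply: (x1P (Some q)).
    by rewrite inE /= map_f.
  rewrite mem_filter qQ andbT => /asboolP/forallNP nv.
  have v x : (hq q).@[hc (f x : abvar B)] = 0 by apply: contrapT; exact: nv.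
  have [[e' he'] _] := hqP q.
  by rewrite v (Zb _ _ he' v) eqxx.
- exists (hc (x1 : abvar A)); split=> // p pl.
  by apply: (vanish_hc homS HS); exact: lS.
have wnz : nonzero w.
  by exists i0; move: wj; rewrite mevalM mevalXU mulf_eq0 negb_or => /andP[].
have [x wx] : exists x : abvar A, proportional w (hc x).
  by apply/(HS w wnz) => p Sp; apply: lz Sp => q ql; apply: wl.
have [c c0 cE] := wx; exists x.
have FE j : (F j).@[w] = c ^+ (d + 1) * (F j).@[hc x] by exact: homog_scale cE.
have xj : (F j0).@[hc x] != 0.
  by move: wj; rewrite FE mulf_eq0 negb_or => /andP[].
have [fxj fxE] := Fx _ xj.
have ac j : acoord j0 (f x : abvar B) j = acoord j0 b j.
  apply: (mulIf wj); rewrite wE !FE mulrCA; congr (_ * _); exact: fxE.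
apply: (@hcoord_inj _ _ (pstr (abvar B))).
exists (hc (f x : abvar B) j0 / hc b j0); first by rewrite mulf_neq0 ?invr_eq0.
by move=> j; rewrite mulrAC -mulrA -/(acoord j0 b j) -ac /acoord mulrCA divff ?mulr1.
Qed.

(* A subgroup containing a nonempty open subset of its closure is closed. *)
Lemma zclosed_image : @zclosed _ (abvar B) (fun b => exists x, f x = b).
Proof.
have [d [g [hg [x1 gx1]] gP]] := image_contains_open.
suff ZH b : image_closure b -> exists x, f x = b.
  have [S [homS HS]] := zclosed_image_closure; exists S; split=> // b.
  rewrite -HS; split=> [[x <-] e p _ pf|/ZH //]; exact: pf.
move=> Zb; have [x gbx] : exists x, g.@[hc (b - f x : abvar B)] != 0.
  apply: contrapT => /forallNP nx; move/negP: gx1; apply; apply/eqP.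
  (* If [g] vanished at all [b - f x], it would vanish at [b - c] for every [c] in the closure; the
     choice [c = b - f x1] contradicts [gx1]. *)
  have := @image_closure_min (fun c : abvar B => g.@[hc (b - c : abvar B)] = 0) _ _
    _ (image_closureB x1 Zb).
  rewrite opprB addrC subrK; apply.
    apply: (@zclosed_preimage _ (abvar B) (abvar B) (fun c => b - c)
      (fun c => g.@[hc c] = 0)); last exact: zclosed_form hg.
    by apply: regular_subf; [exact: regular_const|exact: regular_id].
  by move=> x; apply/eqP/negPn/negP; apply: nx.
have [y fy] := gP _ (image_closureB x Zb) gbx.
by exists (y + x); have [_ ->] := f_hom; rewrite fy subrK.
Qed.

End ClosedImage.

Section Divisible.
Variables (K : closedFieldType) (A : abelian_variety K).

Lemma mulrn_hom n : @homomorphism _ A A (fun x => x *+ n).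
Proof.
split=> [|x y]; last exact: mulrnDl.
by apply: regular_mulrnf; exact: regular_id.
Qed.

(* The closed subgroups n^k A become stationary, so A is the union of the
   translates of some n^k A by the finitely many n^k-torsion points. *)
Lemma divisible n : n%:R != 0 :> K -> forall a : A, exists b, b *+ n = a.
Proof.
move=> n0; pose Z k (a : abvar A) := exists b : A, b *+ (n ^ k) = a.
have [|k a [b <-]|k Zk] := @zclosed_dcc _ _ Z.
- by move=> k; exact: (zclosed_image (mulrn_hom (n ^ k))).
- by exists (b *+ n); rewrite -mulrnA -expnS.
have Zkm m a : Z k a -> Z (k + m)%N a.
  elim: m a => [|m IH] a; first by rewrite addn0.
  case/Zk=> b <-; have /IH[c cE] : Z k (b *+ n ^ k) by exists b.
  by exists c; rewrite addnS expnSr mulrnA cE -mulrnA -expnSr.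
have nk0 : (n ^ k)%:R != 0 :> K by rewrite natrX expf_neq0.
have [s sP] := torsion_finite A nk0.
have trans (t : A) : @zclosed _ (abvar A) (fun a => Z k (a - t)).
  apply: (@zclosed_preimage _ (abvar A) (abvar A) (fun a => a - t)).
    by apply: regular_subf; [exact: regular_id|exact: regular_const].
  exact: (zclosed_image (mulrn_hom (n ^ k))).
have [t _|a|t _ tP] := @irreducible_cover _ (abvar A) _ s
  (fun t a => Z k (a - t)) (ab_irreducible A); first exact: trans.
(* From n^k a = n^(2k) b it follows that a - n^k b is n^k-torsion. *)
- have [b bE] : Z (k + k)%N (a *+ n ^ k) by apply: Zkm; exists a.
  exists (a - b *+ n ^ k).
    by apply: sP; rewrite mulrnBl -mulrnA -expnD bE subrr.
  by exists b; rewrite opprB addrC subrK.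
(* The translate covering A contains 0, so it is the subgroup itself. *)
have ZA a : Z k a.
  have [b bE] := tP 0; have [c cE] := tP a; exists (c - b).
  by rewrite mulrnBl bE cE sub0r opprK subrK.
move=> a; have [b <-] := Zk a (ZA a).
by exists (b *+ n ^ k); rewrite -mulrnA -expnSr.
Qed.

End Divisible.

(** * Idempotents of the rational group ring *)

Section IdempotentDecomposition.
Variables (F : fieldType) (n : nat) (E : 'M[F]_n -> Prop).
Variables (T : Type) (p : T -> 'M[F]_n).
Hypotheses (EM : forall a b, E a -> E b -> E (a *m b))
  (EB : forall a b, E a -> E b -> E (a - b)) (Ep : forall i, E (p i))
  (pp : forall i, p i *m p i = p i)
  (p_meets : forall a, E a -> a != 0 -> exists i, exists2 r, E r & a *m r *m p i != 0)
  (p_divides : forall i a, E a -> a *m p i != 0 -> exists b c,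
    [/\ E b, E c & p i *m b *m (a *m p i) *m (p i *m c *m p i) = p i]).

(** The products [a k *m b k] are orthogonal idempotents with sum [e], and the pair [a k], [b k]
    makes each of them equivalent to the primitive idempotent [p (idx k)]. *)
Definition primitive_decomposition (e : 'M[F]_n) L (idx : 'I_L -> T)
    (a b : 'I_L -> 'M[F]_n) : Prop :=
  [/\ forall k, [/\ E (a k), e *m a k = a k & a k *m p (idx k) = a k],
      forall k, [/\ E (b k), b k *m e = b k & p (idx k) *m b k = b k],
      forall k, b k *m a k = p (idx k),
      forall k l, k != l -> b k *m a l = 0 &
      \sum_k a k *m b k = e].

(** [p_meets] gives a nonzero element of e E p_i and [p_divides] inverts it up to a right factor p_i
    c p_i, which is absorbed into [a]. If [a *m b] were 0, then p_i = p_i p_i = b (a b) a would be 0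
    as well. *)
Lemma split_primitive e : E e -> e *m e = e -> e != 0 ->
  exists i a b, [/\ E a /\ E b, e *m a = a /\ a *m p i = a,
    b *m e = b /\ p i *m b = b, b *m a = p i & a *m b != 0].
Proof.
move=> Ee ee e0; have [i [r Er erp0]] := p_meets Ee e0.
have [b [c [Eb Ec bcE]]] := p_divides (EM Ee Er) erp0.
have pi0 : p i != 0 by apply: contraNneq erp0 => ->; rewrite mulmx0.
exists i, (e *m r *m p i *m (p i *m c *m p i)), (p i *m b *m e).
have ba : p i *m b *m e *m (e *m r *m p i *m (p i *m c *m p i)) = p i.
  by rewrite -[RHS]bcE !mulmxA -(mulmxA _ e e) ee.
split=> //.
- by split; do ?[exact: Ep | exact: Ee | apply: EM].
- by rewrite !mulmxA ee -!mulmxA pp.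
- by rewrite -!mulmxA ee !mulmxA pp.
- apply: contraNneq pi0 => ab0; move: ba.
  set x := e *m r *m _ *m _; set y := p i *m b *m e => yx.
  by rewrite -(pp i) -{2}yx -[X in X *m _]yx -mulmxA [x *m _]mulmxA ab0 mul0mx mulmx0.
Qed.

Lemma exists_primitive_decomposition e : E e -> e *m e = e ->
  exists L (idx : 'I_L -> T) a b, primitive_decomposition e idx a b.
Proof.
move: {2}(\rank e).+1 (ltnSn (\rank e)) => d.
elim: d e => // d IH e; rewrite ltnS => ed Ee ee.
have [e0|e0] := eqVneq e 0.
  have no0 (k : 'I_0) : False by case: k.
  exists 0%N, (fun k => False_rect _ (no0 k)), (fun=> 0), (fun=> 0).
  by split=> [[]//|[]//|[]//|[]//|]; rewrite big_ord0 e0.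
have [i [a0 [b0 [[Ea Eb] [ea ap] [be pb] ba ab0]]]] := split_primitive Ee ee e0.
pose e' := e - a0 *m b0.
have abab : a0 *m b0 *m (a0 *m b0) = a0 *m b0.
  by rewrite mulmxA -(mulmxA a0) ba ap.
have e'e : e' *m e = e' by rewrite mulmxBl ee -mulmxA be.
have ee' : e *m e' = e' by rewrite mulmxBr ee mulmxA ea.
have e'a : e' *m a0 = 0 by rewrite mulmxBl ea -mulmxA ba ap subrr.
have be' : b0 *m e' = 0 by rewrite mulmxBr be mulmxA ba pb subrr.
have e'e' : e' *m e' = e' by rewrite {2}/e' mulmxBr e'e mulmxA e'a mul0mx subr0.
(* If [e] factored as y e', then a0 b0 = e a0 b0 = y e' a0 b0 would be 0, because e' a0 = 0. *)
have rk : (\rank e' < \rank e)%N.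
  have : (e' < e)%MS.
    rewrite ltmxE -{1}e'e submxMl /=; apply/negP => /submxP[y ey].
    move/eqP: ab0; apply; have -> : a0 *m b0 = e *m (a0 *m b0) by rewrite mulmxA ea.
    by rewrite ey -mulmxA [e' *m _]mulmxA e'a mul0mx mulmx0.
  by rewrite ltmxErank => /andP[].
have Ee' : E e' by apply: EB => //; apply: EM.
have [L [idx [a [b [aP bP baP orth sumE]]]]] := IH e' (leq_trans rk ed) Ee' e'e'.
pose ext (U : Type) (x : U) (y : 'I_L -> U) (k : 'I_L.+1) :=
  oapp y x (unlift ord0 k).
have ext0 U x (y : 'I_L -> U) : ext U x y ord0 = x by rewrite /ext unlift_none.
have extS U x (y : 'I_L -> U) k : ext U x y (lift ord0 k) = y k.
  by rewrite /ext liftK.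
exists L.+1, (ext _ i idx), (ext _ a0 a), (ext _ b0 b); split.
- move=> k; case: (unliftP ord0 k) => [k'|] ->; rewrite !(ext0, extS) //.
  have [Eak eak akp] := aP k'; split=> //.
  by rewrite -{1}eak mulmxA ee' eak.
- move=> k; case: (unliftP ord0 k) => [k'|] ->; rewrite !(ext0, extS) //.
  have [Ebk bke pbk] := bP k'; split=> //.
  by rewrite -{1}bke -mulmxA e'e bke.
- by move=> k; case: (unliftP ord0 k) => [k'|] ->; rewrite !(ext0, extS).
- move=> k l; case: (unliftP ord0 k) => [k'|] ->;
    case: (unliftP ord0 l) => [l'|] ->; rewrite !(ext0, extS) ?eqxx //.
  + by rewrite (inj_eq (@lift_inj _ _)); apply: orth.
  + by have [_ <- _] := bP k'; rewrite -mulmxA e'a mulmx0.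
  + by have [_ <- _] := aP l'; rewrite mulmxA be' mul0mx.
- rewrite big_ord_recl !ext0; under eq_bigr => k _ do rewrite !extS.
  by rewrite sumE addrC subrK.
Qed.

End IdempotentDecomposition.

Section RationalGroupRingIdempotents.
Variables (gT : finGroupType).
Local Notation G := [set: gT]%G.
Variables (sG : irrType rat G) (p : sG -> 'M[rat]_#|G|).
Hypothesis p_idem : forall i, is_primitive_idempotent i (p i).
Local Notation R_G := (group_ring rat G).
Local Notation op i := (gring_op (irr_repr (i : sG))).

Lemma rat_pcharG : ([pchar rat]^'.-group G)%g.
Proof.
apply/pgroupP => q q_pr _; rewrite inE /=.
by rewrite Num.Theory.pchar_num.
Qed.

Lemma Wedderburn_group_ring i a :
  (a \in Wedderburn_subring (i : sG))%MS -> (a \in R_G)%MS.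
Proof. by move=> ai; rewrite -(Wedderburn_sum_pchar sG rat_pcharG) (sumsmx_sup i). Qed.

Lemma op_inj i a b : (a \in Wedderburn_subring (i : sG))%MS ->
  (b \in Wedderburn_subring i)%MS -> op i a = op i b -> a = b.
Proof.
have irr := socle_irr i; move=> ai bi.
have := regular_op_inj_pchar (sG := sG) rat_pcharG irr.
by rewrite irr_reprK_pchar ?rat_pcharG //; apply; rewrite inE.
Qed.

Lemma Wedderburn_mull i a b : (a \in R_G)%MS ->
  (b \in Wedderburn_subring (i : sG))%MS -> (a *m b \in Wedderburn_subring i)%MS.
Proof.
move=> Ra bi; have /andP[/mulsmx_subP idl _] := Wedderburn_ideal i.
exact: idl.
Qed.

Lemma Wedderburn_mulr i a b : (a \in Wedderburn_subring (i : sG))%MS ->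
  (b \in R_G)%MS -> (a *m b \in Wedderburn_subring i)%MS.
Proof.
move=> ai Rb; have /andP[_ /mulsmx_subP idr] := Wedderburn_ideal i.
exact: idr.
Qed.

Lemma irr_cyclic i (v w : 'rV[rat]_(irr_degree (i : sG))) : v != 0 ->
  exists2 r, (r \in R_G)%MS & v *m op i r = w.
Proof.
move=> v0; have := mxsimple_cyclic (socle_irr i) v0 (submx1 v).
move/eqmxP => /andP[sub _].
have /cyclic_mxP[A /envelop_mxP[c ->] ->] := submx_trans (submx1 w) sub.
exists (\sum_(x in G) c x *: regular_repr rat G x).
  by apply/envelop_mxP; exists c.
rewrite linear_sum; congr (_ *m _); apply: eq_bigr => x Gx.
by rewrite linearZ /= gring_opG.
Qed.

Lemma p_Wedderburn i : (p i \in Wedderburn_subring i)%MS.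
Proof. by have [] := p_idem i. Qed.

Lemma p_group_ring i : (p i \in R_G)%MS.
Proof. exact: Wedderburn_group_ring (p_Wedderburn i). Qed.

(* The first vector w0 of the basis generates W_i, is fixed by p_i, and
   p_i Q[G] acts through its effect on w0 because the remaining basis vectors
   are killed by p_i. *)
Lemma primitive_idempotentP i : exists w : 'rV[rat]_(irr_degree i),
  [/\ w != 0, w *m op i (p i) = w &
      forall a b, (a \in R_G)%MS -> (b \in R_G)%MS ->
        w *m op i (p i *m a) = w *m op i (p i *m b) -> p i *m a = p i *m b].
Proof.
have [pW [n [w [wB wp]]]] := p_idem i; exists (w ord0); split.
(* If the first basis vector were 0, its coefficient in an expansion of 0 could be both 0 and 1. *)
- apply/eqP => w0; have [c [_ cU]] := wB 0.
  pose d x := [ffun k : 'I_n.+1 => if k == ord0 then x else 0 : 'M[rat]_(irr_degree i)].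
  have dP x : x = 0 \/ x = 1%:M -> (forall k, centgmx (irr_repr i) (d x k)) /\
      0 = \sum_k w k *m d x k.
    move=> xE; split=> [k|].
      rewrite ffunE; apply/centgmxP => y _.
      case: eqP; rewrite ?mul0mx ?mulmx0 //.
      by case: xE => ->; rewrite ?mul0mx ?mulmx0 ?mul1mx ?mulmx1.
    rewrite big1 // => k _; rewrite ffunE; case: eqP => [->|_]; last by rewrite mulmx0.
    by rewrite w0 mul0mx.
  have := cU _ (dP 0 (or_introl erefl)).
  rewrite (cU _ (dP _ (or_intror erefl))) => /ffunP/(_ ord0); rewrite !ffunE eqxx.
  move/(congr1 mxrank); rewrite mxrank1 mxrank0 => d0.
  by have := irr_degree_gt0 i; rewrite d0.
- by rewrite wp eqxx.
- move=> a b Ra Rb E; apply: (@op_inj i); try exact: Wedderburn_mulr.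
  apply/row_matrixP => k; rewrite !rowE.
  have [c [[cC ->] _]] := wB (delta_mx 0 k).
  rewrite !mulmx_suml; apply: eq_bigr => j _.
  have comm x : (x \in R_G)%MS -> w j *m c j *m op i x = w j *m op i x *m c j.
    case/envelop_mxP=> f ->; rewrite linear_sum -!mulmxA; congr (_ *m _).
    rewrite mulmx_sumr mulmx_suml; apply: eq_bigr => y Gy.
    rewrite linearZ /= gring_opG // -scalemxAr -scalemxAl.
    by have /centgmxP -> := cC j.
  rewrite !comm ?envelop_mxM ?p_group_ring //; congr (_ *m _).
  have [->//|j0] := eqVneq j ord0.
  by rewrite !gring_opM // !mulmxA wp (negPf j0) !mul0mx.
Qed.

Lemma primitive_idem i : p i *m p i = p i.
Proof.
have [w [w0 wp wE]] := primitive_idempotentP i.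
rewrite -[RHS]mulmx1; apply: wE; rewrite ?p_group_ring ?envelop_mx1 //.
by rewrite mulmx1 gring_opM ?p_group_ring // mulmxA !wp.
Qed.

(** The identities of the simple factors sum to 1, so [a] acts nontrivially on some W_i. A nonzero
    vector v a can be moved by some [r] to the vector [w] fixed by p_i. *)
Lemma primitive_meets a : (a \in R_G)%MS -> a != 0 ->
  exists i, exists2 r, (r \in R_G)%MS & a *m r *m p i != 0.
Proof.
move=> Ra a0; have [i opa] : exists i, op i a != 0.
  apply: contrapT => /forallNP na; move/eqP: a0; apply.
  rewrite -[a]mulmx1 -(Wedderburn_sum_id_pchar sG rat_pcharG) mulmx_sumr big1 // => i _.
  have ei := Wedderburn_id_mem i.
  apply: (@op_inj i); rewrite ?Wedderburn_mull //; first by rewrite linear0 sub0mx.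
  rewrite gring_opM ?(Wedderburn_group_ring ei) // linear0.
  by have /negP/negPn/eqP -> := na i; rewrite mul0mx.
have [w [w0 wp _]] := primitive_idempotentP i.
have [v va] : exists v : 'rV[rat]_(irr_degree i), v *m op i a != 0.
  apply: contrapT => /forallNP nv; move/eqP: opa; apply; apply/row_matrixP => k.
  by rewrite rowE row0; apply/eqP/negPn/negP/nv.
have [r Rr vr] := irr_cyclic w va; exists i, r => //.
apply: contraNneq w0 => arp; rewrite -wp -vr -!mulmxA -!gring_opM ?p_group_ring //.
  by rewrite mulmxA arp linear0 mulmx0.
by rewrite envelop_mxM ?p_group_ring.
Qed.

(** Schur's lemma in terms of vectors: [b] carries [w] to a vector v not killed by a p_i, and [c]
    carries v a p_i back to [w]. The product begins with p_i and fixes [w], so it equals p_i. *)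
Lemma primitive_divides i a : (a \in R_G)%MS -> a *m p i != 0 -> exists b c,
  [/\ (b \in R_G)%MS, (c \in R_G)%MS &
      p i *m b *m (a *m p i) *m (p i *m c *m p i) = p i].
Proof.
move=> Ra ap0; have [w [w0 wp wE]] := primitive_idempotentP i.
have Rp := p_group_ring i.
have [v va] : exists v : 'rV[rat]_(irr_degree i), v *m op i (a *m p i) != 0.
  apply: contrapT => /forallNP nv; move/eqP: ap0; apply.
  apply: (@op_inj i); rewrite ?Wedderburn_mull ?p_Wedderburn ?linear0 ?sub0mx //.
  by apply/row_matrixP => k; rewrite rowE row0; apply/eqP/negPn/negP/nv.
have [b Rb wb] := irr_cyclic v w0; have [c Rc vc] := irr_cyclic w va.
exists b, c; split=> //.
rewrite -[RHS]mulmx1 -!mulmxA; apply: wE; rewrite ?envelop_mx1 //.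
  by do ?[exact: Rp | exact: Rb | exact: Ra | exact: Rc | apply: envelop_mxM].
rewrite mulmx1 wp !mulmxA -(mulmxA _ (p i) (p i)) primitive_idem.
have -> : p i *m b *m a *m p i *m c *m p i = p i *m b *m (a *m p i) *m c *m p i.
  by rewrite !mulmxA.
rewrite (gring_opM _ _ Rp) (gring_opM _ _ Rc) (gring_opM _ _ (envelop_mxM Ra Rp)).
by rewrite (gring_opM _ _ Rb) !mulmxA wp wb vc wp.
Qed.

Lemma group_ring_decomposition e : (e \in R_G)%MS -> e *m e = e ->
  exists L (idx : 'I_L -> sG) a b,
    primitive_decomposition (fun x => x \in R_G)%MS p e idx a b.
Proof.
apply: exists_primitive_decomposition.
- by move=> a b; apply: envelop_mxM.
- by move=> a b Ra Rb; rewrite linearB addmx_sub // eqmx_opp.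
- exact: p_group_ring.
- exact: primitive_idem.
- exact: primitive_meets.
- exact: primitive_divides.
Qed.

(* e = 0 in the trivial representation, hence so are a_k = e a_k and
   p_i = b_k a_k. *)
Lemma decomposition_nontrivial e L (idx : 'I_L -> sG) a b :
  op [1 sG]%irr e = 0 ->
  primitive_decomposition (fun x => x \in R_G)%MS p e idx a b ->
  forall k, idx k != [1 sG]%irr.
Proof.
move=> op1 [aP bP ba _ _] k; apply/eqP => k1.
have {op1} ope : op (idx k) e = 0 by rewrite k1.
have [w [w0 wp _]] := primitive_idempotentP (idx k).
move/eqP: w0; apply; rewrite -wp -ba.
have [Ra ea _] := aP k; rewrite -ea !gring_opM //; last first.
  by rewrite ea.
by rewrite ope mul0mx !mulmx0.
Qed.

End RationalGroupRingIdempotents.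

(** * Action of the group ring *)

Section GroupRingCoefficients.
Variable gT : finGroupType.
Local Notation G := [set: gT]%G.
Local Notation R_G := (group_ring rat G).
Local Notation aG := (regular_repr rat G).
Local Notation coef := (@gring_coef gT).

Lemma regular_repr_coef x i g :
  aG x i (gring_index G g) = ((enum_val i * x)%g == g)%:R.
Proof.
rewrite /= !mxE eqxx /=; congr (nat_of_bool _)%:R.
rewrite eq_sym; apply/eqP/eqP => [|->//].
by apply: (can_in_inj (gring_indexK (G := G))); rewrite inE.
Qed.

Lemma gring_coef_aG x g : coef (aG x) g = (x == g)%:R.
Proof.
by rewrite /gring_coef /gring_row [LHS]mxE regular_repr_coef gring_indexK ?inE ?mul1g.
Qed.

Lemma gring_coefZ c q g : coef (c *: q) g = c * coef q g.
Proof. by rewrite /gring_coef linearZ [LHS]mxE. Qed.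

Lemma group_ring_coefE q : (q \in R_G)%MS -> q = \sum_g coef q g *: aG g.
Proof.
case/envelop_mxP=> c qE; rewrite {1}qE; apply: eq_big => [g|g _]; first by rewrite inE.
congr (_ *: _); rewrite /gring_coef qE linear_sum summxE (bigD1 g) ?inE //=.
rewrite -/(gring_coef _ g) gring_coefZ gring_coef_aG eqxx mulr1 big1 ?addr0 //.
move=> h /andP[_ /negPf hg].
by rewrite -/(gring_coef _ g) gring_coefZ gring_coef_aG hg mulr0.
Qed.

Lemma gring_coefM q q' g : (q' \in R_G)%MS ->
  coef (q *m q') g = \sum_h coef q h * coef q' (h^-1 * g)%g.
Proof.
move=> Rq'; rewrite /gring_coef gring_row_mul mxE.
rewrite (reindex (gring_index G)); last first.
  exists enum_val => i _; [by rewrite gring_indexK ?inE|exact: gring_valK].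
apply: eq_bigr => h _; congr (_ * _).
rewrite {1}(group_ring_coefE Rq') summxE (bigD1 (h^-1 * g)%g) //=.
rewrite [X in X + _]mxE regular_repr_coef gring_indexK ?inE // mulKVg eqxx mulr1.
rewrite big1 ?addr0 // => x; rewrite [in _ -> _]mxE regular_repr_coef gring_indexK ?inE //.
by rewrite (can2_eq (mulKg h) (mulKVg h)) => /negPf ->; rewrite mulr0.
Qed.

Lemma gring_coefD q q' g : coef (q + q') g = coef q g + coef q' g.
Proof. by rewrite /gring_coef linearD mxE. Qed.

Lemma gring_coefN q g : coef (- q) g = - coef q g.
Proof. by rewrite /gring_coef linearN mxE. Qed.

Definition integral_multiple (D : nat) q : Prop :=
  forall g, D%:R * coef q g \is a Num.int.

Lemma integral_multipleM D D' q q' : (q' \in R_G)%MS ->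
  integral_multiple D q -> integral_multiple D' q' ->
  integral_multiple (D * D') (q *m q').
Proof.
move=> Rq' Dq Dq' g; rewrite gring_coefM // mulr_sumr.
by apply: rpred_sum => h _; rewrite natrM mulrACA rpredM.
Qed.

Lemma integral_multipleD D q q' : integral_multiple D q ->
  integral_multiple D q' -> integral_multiple D (q + q').
Proof. by move=> Dq Dq' g; rewrite gring_coefD mulrDr rpredD. Qed.

Lemma integral_multipleN D q : integral_multiple D q -> integral_multiple D (- q).
Proof. by move=> Dq g; rewrite gring_coefN mulrN rpredN. Qed.

Lemma integral_multiple_dvd D D' q :
  (D %| D')%N -> integral_multiple D q -> integral_multiple D' q.
Proof.
by move=> /dvdnP[c ->] Dq g; rewrite natrM -mulrA rpredM // rpred_nat.
Qed.

Lemma common_denominator (T : finType) (q : T -> 'M[rat]_#|G|) :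
  exists2 D, (0 < D)%N & forall t, integral_multiple D (q t).
Proof.
pose d t g := `|denq (coef (q t) g)|%N.
exists (\prod_t \prod_g d t g)%N => [|t g].
  by do 2?[apply: prodn_gt0 => ?]; rewrite absz_gt0 denq_eq0.
rewrite (bigD1 t) //= (bigD1 g) //= -mulnA mulnC natrM -mulrA.
have -> : (d t g)%:R * coef (q t) g = (numq (coef (q t) g))%:~R.
  by rewrite numqE mulrC pmulrn absz_denq.
by rewrite rpredM ?rpred_nat ?rpred_int.
Qed.

Definition subgroup_mean (H : {group gT}) : 'M[rat]_#|G| :=
  #|H|%:R^-1 *: \sum_(h in H) aG h.

Lemma subgroup_mean_ring (H : {group gT}) : (subgroup_mean H \in R_G)%MS.
Proof.
apply/envelop_mxP; exists (fun g => #|H|%:R^-1 * (g \in H)%:R).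
rewrite /subgroup_mean scaler_sumr [RHS](bigID (mem H)) /=.
rewrite [X in _ = _ + X]big1 ?addr0; last first.
  by move=> g /andP[_ /negPf ->]; rewrite mulr0 scale0r.
by apply: eq_big => [g|g ->]; rewrite ?inE ?mulr1.
Qed.

Lemma mul_aG_mean (H : {group gT}) g :
  g \in H -> aG g *m subgroup_mean H = subgroup_mean H.
Proof.
move=> gH; rewrite -scalemxAr mulmx_sumr; congr (_ *: _).
rewrite [RHS](reindex_inj (mulgI g)) /=; apply: eq_big => [h|h _].
  by rewrite groupMl.
by rewrite repr_mxM ?inE.
Qed.

Lemma mul_mean_aG (H : {group gT}) g :
  g \in H -> subgroup_mean H *m aG g = subgroup_mean H.
Proof.
move=> gH; rewrite -scalemxAl mulmx_suml; congr (_ *: _).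
rewrite [RHS](reindex_inj (mulIg g)) /=; apply: eq_big => [h|h _].
  by rewrite groupMr.
by rewrite repr_mxM ?inE.
Qed.

Lemma card_group_neq0 (H : {group gT}) : #|H|%:R != 0 :> rat.
Proof. by rewrite Num.Theory.pnatr_eq0 -lt0n cardG_gt0. Qed.

Lemma mul_mean_mean (M N : {group gT}) : M \subset N ->
  subgroup_mean M *m subgroup_mean N = subgroup_mean N /\
  subgroup_mean N *m subgroup_mean M = subgroup_mean N.
Proof.
move=> sMN; split.
  rewrite -scalemxAl mulmx_suml (eq_bigr (fun=> subgroup_mean N)).
    by rewrite sumr_const -scaler_nat scalerA mulVf ?scale1r // card_group_neq0.
  by move=> h hM; rewrite mul_aG_mean // (subsetP sMN).
rewrite -scalemxAr mulmx_sumr (eq_bigr (fun=> subgroup_mean N)).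
  by rewrite sumr_const -scaler_nat scalerA mulVf ?scale1r // card_group_neq0.
by move=> h hM; rewrite mul_mean_aG // (subsetP sMN).
Qed.

Lemma integral_mean (H : {group gT}) : integral_multiple #|H| (subgroup_mean H).
Proof.
move=> g; rewrite gring_coefZ mulrA divff ?card_group_neq0 // mul1r.
rewrite /gring_coef linear_sum summxE rpred_sum // => h _.
by rewrite -/(gring_coef _ g) gring_coef_aG rpred_nat.
Qed.

Section Action.
Variables (J : zmodType) (rho : gT -> J -> J).
Hypotheses (rhoD : forall g a b, rho g (a + b) = rho g a + rho g b)
  (rhoM : forall g h a, rho (g * h)%g a = rho h (rho g a)).

(* The action of D q, which must have integer coefficients: numq takes the
   numerators of the others. *)
Definition gring_act (D : nat) q (a : J) : J :=
  \sum_g rho g a *~ numq (D%:R * coef q g).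

Lemma rho0 g : rho g 0 = 0.
Proof. by apply: (@addIr _ (rho g 0)); rewrite -rhoD !add0r. Qed.

Lemma rho_sum g (T : Type) (r : seq T) (F : T -> J) :
  rho g (\sum_(i <- r) F i) = \sum_(i <- r) rho g (F i).
Proof. exact: (big_morph _ (rhoD g) (rho0 g)). Qed.

Lemma rhoMz g a (z : int) : rho g (a *~ z) = rho g a *~ z.
Proof.
have rhoMn n : rho g (a *+ n) = rho g a *+ n.
  by elim: n => [|n IH]; rewrite ?rho0 // !mulrS rhoD IH.
have rhoN b : rho g (- b) = - rho g b.
  by apply: (@addIr _ (rho g b)); rewrite -rhoD !addNr rho0.
by case: z => n; rewrite ?NegzE ?mulrNz ?rhoN -!pmulrn rhoMn.
Qed.

Lemma gring_act_int D q (z : gT -> int) a : (forall g, (z g)%:~R = D%:R * coef q g) ->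
  gring_act D q a = \sum_g rho g a *~ z g.
Proof. by move=> zE; apply: eq_bigr => g _; rewrite -zE numq_int. Qed.

Lemma gring_act_addl D q q' a : integral_multiple D q -> integral_multiple D q' ->
  gring_act D (q + q') a = gring_act D q a + gring_act D q' a.
Proof.
move=> Dq Dq'.
rewrite (gring_act_int (z := fun g => numq (D%:R * coef q g) + numq (D%:R * coef q' g))).
  by rewrite -big_split; apply: eq_bigr => g _; rewrite mulrzDr.
by move=> g; rewrite rmorphD /= !numqK ?Dq ?Dq' // gring_coefD mulrDr.
Qed.

Lemma gring_act_oppl D q a : integral_multiple D q -> gring_act D (- q) a = - gring_act D q a.
Proof.
move=> Dq; rewrite (gring_act_int (z := fun g => - numq (D%:R * coef q g))).
  by rewrite -sumrN; apply: eq_bigr => g _; rewrite mulrNz.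
by move=> g; rewrite rmorphN /= numqK ?Dq // gring_coefN mulrN.
Qed.

Lemma gring_act0 D a : gring_act D 0 a = 0.
Proof.
rewrite (gring_act_int (z := fun=> 0)) ?big1 // => g.
by rewrite /gring_coef linear0 mxE mulr0.
Qed.

Lemma gring_act_sum D (T : finType) (q : T -> 'M[rat]_#|G|) a :
  (forall t, integral_multiple D (q t)) ->
  gring_act D (\sum_t q t) a = \sum_t gring_act D (q t) a.
Proof.
move=> Dq; elim: (index_enum T) => [|t r IH]; first by rewrite !big_nil gring_act0.
rewrite !big_cons gring_act_addl ?IH //.
elim: r {IH} => [|t' r IH]; last by rewrite big_cons; apply: integral_multipleD.
by rewrite big_nil => g; rewrite /gring_coef linear0 mxE mulr0.
Qed.

Lemma gring_act_natmul c D q a :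
  integral_multiple D q -> gring_act (c * D) q a = gring_act D q a *+ c.
Proof.
move=> Dq; rewrite (gring_act_int (z := fun g => numq (D%:R * coef q g) * c%:Z)).
  by rewrite -sumrMnl; apply: eq_bigr => g _; rewrite mulrzA pmulrn.
by move=> g; rewrite rmorphM /= numqK ?Dq // natrM -mulrA mulrC pmulrn.
Qed.

(** Products are in diagrammatic order, so [q] acts first. The denominators multiply. *)
Lemma gring_actM D D' q q' a : (q' \in R_G)%MS ->
  integral_multiple D q -> integral_multiple D' q' ->
  gring_act D' q' (gring_act D q a) = gring_act (D * D') (q *m q') a.
Proof.
move=> Rq' Dq Dq'; pose z g := numq (D%:R * coef q g).
pose z' g := numq (D'%:R * coef q' g).
rewrite (gring_act_int (q := q *m q') (z := fun g => \sum_h z h * z' (h^-1 * g)%g)).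
  rewrite /gring_act; under eq_bigr => g _ do rewrite rho_sum mulrz_suml.
  rewrite exchange_big /=; under [RHS]eq_bigr => g _ do rewrite mulrz_sumr.
  rewrite [RHS]exchange_big /=; apply: eq_bigr => h _.
  rewrite [RHS](reindex_inj (mulgI h)) /=; apply: eq_bigr => g _.
  by rewrite mulKg rhoM rhoMz -mulrzA.
move=> g; rewrite gring_coefM // mulr_sumr rmorph_sum; apply: eq_bigr => h _.
by rewrite rmorphM /= !numqK ?Dq ?Dq' // natrM mulrACA.
Qed.

Lemma gring_act_mean (H : {group gT}) a :
  gring_act #|H| (subgroup_mean H) a = \sum_(h in H) rho h a.
Proof.
rewrite (gring_act_int (z := fun g => (g \in H)%:R)).
  by rewrite [RHS]big_mkcond; apply: eq_bigr => g _; case: (g \in H).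
move=> g; rewrite gring_coefZ mulrA divff ?card_group_neq0 // mul1r rmorph_nat.
rewrite /gring_coef linear_sum summxE; under eq_bigr => h _ do
  rewrite -/(gring_coef _ g) gring_coef_aG.
case: (boolP (g \in H)) => gH.
  rewrite (bigD1 g) //= eqxx big1 ?addr0 // => h /andP[_ /negPf -> //].
by rewrite big1 // => h hH; case: eqP gH => // <-; rewrite hH.
Qed.

End Action.

Lemma gring_op_mean1 (sG : irrType rat G) (H : {group gT}) :
  gring_op (irr_repr [1 sG]%irr) (subgroup_mean H) = 1%:M.
Proof.
rewrite linearZ linear_sum /= (eq_bigr (fun=> 1%:M)) => [|h _].
  by rewrite sumr_const -scaler_nat scalerA mulVf ?scale1r // card_group_neq0.
by rewrite gring_opG ?irr1_repr ?inE.
Qed.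

End GroupRingCoefficients.

(** * Jacobians of quotient curves *)

Section Homomorphisms.
Variable K : closedFieldType.
Implicit Types A B C : abelian_variety K.

Lemma hom_sum A B (f : A -> B) (T : Type) (r : seq T) (P : pred T) (F : T -> A) :
  homomorphism f -> f (\sum_(i <- r | P i) F i) = \sum_(i <- r | P i) f (F i).
Proof. by move=> fh; have [_ fD] := fh; exact: (big_morph f fD (hom0 fh)). Qed.

Lemma homMn A B (f : A -> B) n a : homomorphism f -> f (a *+ n) = f a *+ n.
Proof.
move=> fh; have [_ fD] := fh; elim: n => [|n IH]; first exact: hom0.
by rewrite !mulrS fD IH.
Qed.

Lemma hom_comp A B C (f : A -> B) (g : B -> C) :
  homomorphism f -> homomorphism g -> homomorphism (fun a => g (f a)).
Proof.
move=> [rf fD] [rg gD]; split=> [|a b]; last by rewrite fD gD.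
exact: (regular_comp rf rg).
Qed.

Lemma hom_sumf A B (T : Type) (r : seq T) (F : T -> A -> B) :
  (forall i, homomorphism (F i)) -> homomorphism (fun a => \sum_(i <- r) F i a).
Proof.
move=> Fh; split=> [|a b]; first by apply: regular_sumf => i; have [] := Fh i.
by rewrite -big_split; apply: eq_bigr => i _; have [_ ->] := Fh i.
Qed.

Lemma homMz A B (f : A -> B) (z : int) :
  homomorphism f -> homomorphism (fun a => f a *~ z).
Proof.
move=> [rf fD]; split=> [|a b]; last by rewrite fD mulrzDl.
have rz n : @regular _ (abvar A) (abvar B) (fun a => f a *+ n).
  exact: regular_mulrnf.
case: z => n; first exact: rz.
exact: regular_oppf (rz n.+1).
Qed.

(** This turns endomorphisms of Jacobians into homomorphisms to the B_i and to P. *)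
Lemma hom_factor A B C (i : B -> A) (g : C -> A) :
  homomorphism i -> @closed_immersion _ (abvar B) (abvar A) i ->
  homomorphism g -> (forall c, exists b, i b = g c) ->
  exists2 h : C -> B, homomorphism h & forall c, i (h c) = g c.
Proof.
move=> [_ iD] ci [rg gD] /choice[h hE]; exists h => //; split.
  apply: (@regular_factor _ (abvar C) (abvar B) (abvar A) i h ci).
  by have -> : i \o h = g by apply/funext => c; rewrite /= hE.
by move=> a b; have [_ inj _] := ci; apply: inj; rewrite iD !hE gD.
Qed.

(** The image of an irreducible group is connected and contains 0, so inside the kernel it lies in
    the component of 0. *)
Lemma image_connected_component A B C (nm : A -> B) (g : C -> A) :
  homomorphism g -> (forall c, nm (g c) = 0) ->
  forall c, @connected_component _ (abvar A) (fun a => nm a = 0) 0 (g c).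
Proof.
move=> gh ng c; exists (fun a => exists c, g c = a); split.
- move=> Z1 Z2 c1 c2 cov _; have [_ irC] := ab_irreducible C.
  have [rg _] := gh.
  have [x _|Z|Z] := irC _ _ (zclosed_preimage rg c1) (zclosed_preimage rg c2).
  + by apply: cov; exists x.
  + by left=> _ [x <-]; apply: Z.
  + by right=> _ [x <-]; apply: Z.
- by move=> _ [x <-].
- by exists 0; exact: hom0 gh.
- by exists c.
Qed.

Lemma connected_component_sub (X : variety K) (Z : X -> Prop) x y :
  connected_component Z x y -> Z y.
Proof. by case=> C [_ CZ _ /CZ]. Qed.

End Homomorphisms.

Section Jacobian.
Variables (K : closedFieldType) (X : variety K) (J : abelian_variety K) (u : X -> J).
Hypothesis jac : is_jacobian u.

(** The classes of the divisors x - y generate the Jacobian. *)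
Lemma jacobian_ext (V : zmodType) (f g : J -> V) :
  (forall a b, f (a + b) = f a + f b) -> (forall a b, g (a + b) = g a + g b) ->
  (forall x y, f (u x - u y) = g (u x - u y)) -> forall a, f a = g a.
Proof.
move=> fD gD fg a; have [s [t [st ->]]] := jacobian_surj jac a.
have f0 : f 0 = 0 by apply: (@addIr _ (f 0)); rewrite -fD !add0r.
have g0 : g 0 = 0 by apply: (@addIr _ (g 0)); rewrite -gD !add0r.
elim: s t st => [|x s IH] [|y t] //= st; first by rewrite !big_nil subrr f0 g0.
by rewrite !big_cons opprD addrACA fD gD fg IH //; case: st.
Qed.

Lemma jacobian_lift (A : abelian_variety K) (F : X -> A) :
  @regular _ X (abvar A) F ->
  exists2 h : J -> A, homomorphism h & forall x y, h (u x - u y) = F x - F y.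
Proof.
case/(jacobian_universal jac) => h hh [c hE]; exists h => // x y.
by rewrite (homB hh) !hE opprD addrACA subrr addr0.
Qed.

End Jacobian.

Section QuotientJacobian.
Variables (K : closedFieldType) (gT : finGroupType) (X : variety K).
Variables (to : {action gT &-> X}) (to_aut : acts_by_automorphisms to).
Variables (JX : abelian_variety K) (u : X -> JX) (JX_jac : is_jacobian u).
Variables (rho : gT -> JX -> JX)
  (rho_def : forall h, is_norm_map (fun x => to x h) u u (rho h)).

Lemma act_mul x g h : to x (g * h)%g = to (to x g) h.
Proof.
have [_ toM] : is_action [set: gT] to by case: (to).
by rewrite toM ?inE.
Qed.

Lemma rhoJ_add g a b : rho g (a + b) = rho g a + rho g b.
Proof. by have [[_ ->] _] := rho_def g. Qed.

Lemma rhoJ_mul g h a : rho (g * h)%g a = rho h (rho g a).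
Proof.
apply: (jacobian_ext JX_jac (f := rho (g * h)%g) (g := fun a => rho h (rho g a)))
  => [{}a b|{}a b|x y]; try by rewrite !rhoJ_add.
have [_ rgh] := rho_def (g * h)%g; have [_ rg] := rho_def g.
by have [_ rh] := rho_def h; rewrite rgh rg rh /= !act_mul.
Qed.

(* f is the norm map of X -> X/M and t is the pullback of divisors. *)
Lemma quotient_transfer (M : {group gT}) (XM : variety K) (piM : X -> XM)
    (JM : abelian_variety K) (uM : XM -> JM) :
  is_quotient to M piM -> is_jacobian uM ->
  exists (f : JX -> JM) (t : JM -> JX),
  [/\ homomorphism f /\ homomorphism t,
      forall x y, f (u x - u y) = uM (piM x) - uM (piM y),
      forall a, t (f a) = \sum_(h in M) rho h a,
      forall b, f (t b) = b *+ #|M| &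
      forall h a, h \in M -> f (rho h a) = f a].
Proof.
move=> [rpi pi_surj pi_eq pi_univ] JM_jac.
have [f fh fE] : exists2 f : JX -> JM, homomorphism f &
    forall x y, f (u x - u y) = uM (piM x) - uM (piM y).
  exact: (jacobian_lift JX_jac (regular_comp rpi (jacobian_regular JM_jac))).
(* This is the class of the fibre of [piM] through [x], with multiplicities. It is constant on
   M-orbits and so descends to [XM]. *)
pose S (x : X) : JX := \sum_(h in M) u (to x h).
have rS : @regular _ X (abvar JX) S.
  have -> : S = (fun x => \sum_(h <- enum M) u (to x h)).
    by apply/funext => x; rewrite /S big_enum.
  apply: regular_sumf => h; have [ra _] := to_aut.
  exact: (regular_comp (ra h) (jacobian_regular JX_jac)).
have [|S' rS' S'E] := pi_univ (abvar JX) S rS.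
  move=> x g gM; rewrite /S [RHS](reindex_inj (mulgI g)) /=.
  apply: eq_big => [h|h _]; first by rewrite groupMl.
  by rewrite act_mul.
have [t th tE] := jacobian_lift JM_jac rS'.
have tS x y : t (uM (piM x) - uM (piM y)) = \sum_(h in M) (u (to x h) - u (to y h)).
  by rewrite tE !S'E sumrB.
have [_ fD] := fh; have [_ tD] := th.
have pi_inv h x : h \in M -> piM (to x h) = piM x.
  by move=> hM; apply/esym/pi_eq; exists h.
exists f, t; split=> //.
- apply: (jacobian_ext JX_jac (f := fun a => t (f a))
    (g := fun a => \sum_(h in M) rho h a)) => [a b|a b|x y]; first by rewrite fD tD.
    by rewrite -big_split; apply: eq_bigr => h _; rewrite rhoJ_add.
  rewrite fE tS; apply: eq_bigr => h _.
  by have [_ ->] := rho_def h.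
- apply: (jacobian_ext JM_jac (f := fun b => f (t b))
    (g := fun b => b *+ #|M|)) => [a b|a b|x' y']; first by rewrite tD fD.
    by rewrite mulrnDl.
  have [x <-] := pi_surj x'; have [y <-] := pi_surj y'.
  rewrite tS (hom_sum _ _ _ fh) -sumr_const; apply: eq_bigr => h hM.
  by rewrite fE !pi_inv.
- move=> h a hM; apply: (jacobian_ext JX_jac (f := fun a => f (rho h a)) (g := f))
    => [{}a b|{}a b|x y] //.
    by rewrite rhoJ_add fD.
  by have [_ ->] := rho_def h; rewrite !fE !pi_inv.
Qed.

End QuotientJacobian.

(** * The isogeny *)

Section ProductIsogeny.
Variables (K : closedFieldType) (P : abelian_variety K) (I : eqType).
Variables (B : I -> abelian_variety K) (phi : forall k, P -> B k).
Hypothesis phi_hom : forall k, homomorphism (phi k).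
Hypothesis phi_surj : forall k (y : B k),
  exists2 x, phi k x = y & forall j, j != k -> phi j x = 0.

(** By [phi_surj] one component can be prescribed with all the others 0, so preimages of the
    components add up. As [l] has no repetitions, the preimage for its head is killed by the map to
    the tail. *)
Lemma hom_to_product (l : seq I) : uniq l ->
  exists Phi : P -> big_prod_ab (map B l),
  [/\ homomorphism Phi, forall x, Phi x = 0 <-> forall k, k \in l -> phi k x = 0 &
      forall y, exists2 x, Phi x = y & forall j, j \notin l -> phi j x = 0].
Proof.
elim: l => [_|k l IH /= /andP[kl /IH[Phi [[rPhi PhiD] Phi0 Phi_surj]]]].
  have zero_unique (z : big_prod_ab (map B [::])) : z = 0.
    by rewrite (ord1 (z : 'I_1)) [RHS](ord1 (0 : 'I_1)).
  exists (fun=> 0); split=> [||y].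
  - by split=> [|x y]; [exact: unit_regular|rewrite [RHS]zero_unique].
  - by split.
  - by exists 0 => [|j _]; [rewrite [RHS]zero_unique|apply: hom0].
exists (fun x => (phi k x, Phi x)); have [rk kD] := phi_hom k; split.
- split=> [|x y]; last by rewrite kD PhiD.
  exact: (@regular_pair _ (abvar (B k)) (abvar (big_prod_ab (map B l))) (abvar P)).
- move=> x; split=> [[k0 /Phi0 P0] j|P0].
    by rewrite inE => /predU1P[->|/P0].
  have -> : phi k x = 0 by apply: P0; rewrite mem_head.
  by have -> : Phi x = 0 by apply/Phi0 => j jl; apply: P0; rewrite inE jl orbT.
- case=> y1 y2; have [x2 Px2 x2l] := Phi_surj y2.
  have [x1 Px1 x1k] := phi_surj (y1 - phi k x2); exists (x1 + x2).
    have Px1' : Phi x1 = 0.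
      by apply/Phi0 => j jl; apply: x1k; apply: contraNneq kl => <-.
    by rewrite kD PhiD Px1 Px1' Px2 subrK add0r.
  move=> j; rewrite inE negb_or => /andP[jk jl].
  by have [_ ->] := phi_hom j; rewrite x1k // x2l // addr0.
Qed.

End ProductIsogeny.

(** Reordering the indices so that equal representations become adjacent makes the product of the
    B_(i_k) literally equal to the product of powers, with no isogeny permuting factors. *)
Lemma sort_by_value (T : finType) (V : eqType) (idx : T -> V) (r : seq V) :
  uniq r -> exists2 l : seq T, uniq l /\ (forall k, idx k \in r -> k \in l) &
    forall (U : Type) (B : V -> U),
      [seq B (idx k) | k <- l]
      = flatten [seq nseq (count_mem i [seq idx k | k <- enum T]) (B i) | i <- r].
Proof.
move=> ur; exists (flatten [seq [seq k <- enum T | idx k == i] | i <- r]).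
  split; last first.
    move=> k kr; apply/flatten_mapP; exists (idx k) => //.
    by rewrite mem_filter eqxx mem_enum.
  elim: r ur => //= i r IH /andP[ir /IH ur]; rewrite cat_uniq ur andbT.
  rewrite filter_uniq ?enum_uniq //=; apply/hasPn => k /flatten_mapP[j jr].
  rewrite !mem_filter => /andP[/eqP -> _]; rewrite negb_and.
  by apply/orP; left; apply: contraNneq ir => <-.
move=> U B; rewrite map_flatten -map_comp; congr flatten; apply: eq_map => i /=.
rewrite count_map; elim: (enum T) => //= k s IH.
by case: eqP => /= [->|_]; rewrite IH.
Qed.

Section PrymIsogeny.
Variables (K : closedFieldType) (char0 : forall n, (0 < n)%N -> n%:R != 0 :> K).
Variables (X : variety K) (gT : finGroupType) (to : {action gT &-> X}).
Variables (to_aut : acts_by_automorphisms to).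
Variables (M N : {group gT}) (sMN : M \subset N) (XM XN : variety K).
Variables (piM : X -> XM) (piM_quo : is_quotient to M piM).
Variables (piN : X -> XN) (piN_quo : is_quotient to N piN).
Variables (psi : XM -> XN) (psi_def : forall x, psi (piM x) = piN x).
Variables (JX JXM JXN : abelian_variety K).
Variables (u : X -> JX) (JX_jac : is_jacobian u).
Variables (uM : XM -> JXM) (JXM_jac : is_jacobian uM).
Variables (uN : XN -> JXN) (JXN_jac : is_jacobian uN).
Variables (rho : gT -> JX -> JX)
  (rho_def : forall h, is_norm_map (fun x => to x h) u u (rho h)).
Variables (nm : JXM -> JXN) (nm_def : is_norm_map psi uM uN nm).
Variables (P : abelian_variety K) (iP : P -> JXM) (P_prym : is_prym nm iP).
Variables (sG : irrType rat [set: gT]%G).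
Variables (p : sG -> 'M[rat]_#|[set: gT]%G|)
  (p_idem : forall i, is_primitive_idempotent i (p i)).
Variables (B : sG -> abelian_variety K) (iB : forall i, B i -> JX).
Variables (ImP : sG -> JX -> Prop)
  (ImP_def : forall i, is_gring_image rho (p i) (ImP i))
  (B_sub : forall i, abelian_subvariety (@iB i) (ImP i)).

Local Notation R_G := (group_ring rat [set: gT]%G).
Local Notation e := (subgroup_mean M - subgroup_mean N).

Let rhoD g a b : rho g (a + b) = rho g a + rho g b := rhoJ_add rho_def g a b.
Let rhoM g h a : rho (g * h)%g a = rho h (rho g a) := rhoJ_mul JX_jac rho_def g h a.

Lemma gring_act_hom D q : homomorphism (gring_act rho D q).
Proof. by apply: hom_sumf => g; apply: homMz; have [] := rho_def g. Qed.

Lemma mean_diff_idem : e *m e = e.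
Proof.
have [MM _] := mul_mean_mean (subxx M); have [NN _] := mul_mean_mean (subxx N).
have [MN NM] := mul_mean_mean sMN.
by rewrite mulmxBl !mulmxBr MM NN MN NM subrr subr0.
Qed.

Lemma mean_diff_mean : e *m subgroup_mean M = e.
Proof.
have [MM _] := mul_mean_mean (subxx M); have [_ NM] := mul_mean_mean sMN.
by rewrite mulmxBl MM NM.
Qed.

Lemma mean_diff_ring : (e \in R_G)%MS.
Proof. by rewrite linearB addmx_sub ?eqmx_opp ?subgroup_mean_ring. Qed.

(** Im(p_i) is given through some multiplier m_i. Since D is a multiple of m_i, the image of D p_i
    lies in Im(p_i), and there D p_i acts as multiplication by D because p_i is idempotent. *)
Lemma uniform_denominator (L : nat) (a b : 'I_L -> 'M[rat]_#|[set: gT]%G|) :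
  exists D, [/\ (0 < D)%N, (#|M| %| D)%N /\ (#|N| %| D)%N,
    forall k, integral_multiple D (a k) /\ integral_multiple D (b k),
    forall i, integral_multiple D (p i) &
    (forall i y, ImP i (gring_act rho D (p i) y)) /\
    (forall i y, ImP i y -> gring_act rho D (p i) y = y *+ D)].
Proof.
have /choice[m mP] i : exists m, (0 < m)%N /\ integral_multiple m (p i) /\
    forall y, ImP i y <-> exists x, y = gring_act rho m (p i) x.
  have [m [z [m0 zE zP]]] := ImP_def i; exists m; split=> //; split=> [g|y].
    by rewrite -zE rpred_int.
  by rewrite zP; split=> -[x ->]; exists x; rewrite (gring_act_int rho x zE).
have [Da Da0 DaP] := common_denominator a.
have [Db Db0 DbP] := common_denominator b.
pose D := (\prod_i m i * (#|M| * (#|N| * (Da * Db))))%N.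
have mD i : (m i %| D)%N by rewrite /D (bigD1 i) //= -mulnA dvdn_mulr.
exists D; split.
- rewrite !muln_gt0 !cardG_gt0 Da0 Db0 !andbT.
  by apply: prodn_gt0 => i; have [] := mP i.
- by split; do 3?[exact: dvdn_mulr | apply: dvdn_mull].
- move=> k; split; [apply: integral_multiple_dvd (DaP k)|apply: integral_multiple_dvd (DbP k)].
    by do 3?apply: dvdn_mull; exact: dvdn_mulr.
  by do 3?apply: dvdn_mull; exact: dvdn_mull.
- by move=> i; have [_ [mi _]] := mP i; apply: integral_multiple_dvd mi.
- split=> i y; have [_ [mi ImE]] := mP i; have /dvdnP[c ->] := mD i.
    apply/ImE; exists (y *+ c); rewrite gring_act_natmul //.
    by rewrite (homMn _ _ (gring_act_hom _ _)).
  case/ImE=> x ->; rewrite gring_act_natmul // (gring_actM rhoD rhoM) ?p_group_ring //.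
  by rewrite primitive_idem // gring_act_natmul // -mulrnA mulnC.
Qed.

Lemma prym_isogenous_product : exists s : sG -> nat,
  isogenous P (big_prod_ab
    (flatten [seq nseq (s i) (B i) | i <- enum sG & i != [1 sG]%irr])).
Proof.
have [f [t [[fh th] fE tf ft _]]] :=
  quotient_transfer to_aut JX_jac rho_def piM_quo JXM_jac.
have [fN [tN [[fNh tNh] fNE tNfN _ fN_inv]]] :=
  quotient_transfer to_aut JX_jac rho_def piN_quo JXN_jac.
have [nmh nmE] := nm_def.
have nmf a : nm (f a) = fN a.
  have [_ fD] := fh; have [_ nmD] := nmh; have [_ fND] := fNh.
  apply: (jacobian_ext JX_jac (f := fun a => nm (f a)) (g := fN))
    => [{}a b|//|x y]; first by rewrite fD nmD.
  by rewrite fE nmE !psi_def fNE.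
have [iPh iPci iPcomp] := P_prym; have [_ iP_inj _] := iPci.
have nmP x : nm (iP x) = 0.
  by apply: connected_component_sub ((iPcomp (iP x)).2 _); exists x.
have [L [idx [a [b dec]]]] :=
  group_ring_decomposition p_idem mean_diff_ring mean_diff_idem.
have idx1 : forall k, idx k != [1 sG]%irr.
  apply: (decomposition_nontrivial p_idem _ dec).
  by rewrite linearB /= !gring_op_mean1 subrr.
have [aP bP ba orth sum_ab] := dec.
have [D [D0 [MD ND] /all_and2[Da Db] Dp [ImD ImDE]]] := uniform_denominator a b.
have DM := integral_multiple_dvd MD (integral_mean M).
have DN := integral_multiple_dvd ND (integral_mean N).
have De : integral_multiple D e.
  by apply: integral_multipleD => //; apply: integral_multipleN.
have acteE y : gring_act rho D e y =
    gring_act rho D (subgroup_mean M) y - gring_act rho D (subgroup_mean N) y.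
  by rewrite gring_act_addl ?gring_act_oppl //; apply: integral_multipleN.
have act_mean (H : {group gT}) y : (#|H| %| D)%N ->
    gring_act rho D (subgroup_mean H) y = (\sum_(h in H) rho h y) *+ (D %/ #|H|).
  move=> HD; rewrite -{1}(divnK HD) gring_act_natmul ?gring_act_mean //.
  exact: integral_mean.
have fN_mean (H : {group gT}) y : H \subset N -> (#|H| %| D)%N ->
    fN (gring_act rho D (subgroup_mean H) y) = fN y *+ D.
  move=> sHN HD; rewrite act_mean // (homMn _ _ fNh) (hom_sum _ _ _ fNh).
  rewrite (eq_bigr (fun=> fN y)) => [|h hH]; last by rewrite fN_inv // (subsetP sHN).
  by rewrite sumr_const -mulrnA mulnC divnK.
(* Both means have the same effect under [fN], which is invariant under N and hence under M. *)
have fN_e y : fN (gring_act rho D e y) = 0.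
  by rewrite acteE (homB fNh) !fN_mean // subrr.
(* On t z the sum over M is t f t z = |M| t z, while the sum over N factors through nm z = 0. *)
have e_t z : nm z = 0 -> gring_act rho D e (t z) = t z *+ D.
  move=> nz; rewrite acteE !act_mean // -tf -tNfN ft -nmf ft (homMn _ _ nmh) nz mul0rn.
  by rewrite (hom0 tNh) mul0rn subr0 (homMn _ _ th) -mulrnA mulnC divnK.
(* Although a_k p = a_k, the action of D p is applied as well, so that the value visibly lies in
   Im(p); this costs one more factor D. *)
have phi_ex k : exists2 h : P -> B (idx k), homomorphism h & forall x,
    iB (h x) = gring_act rho D (p (idx k)) (gring_act rho D (a k) (t (iP x))).
  have [iBh iBci iBE] := B_sub (idx k).
  apply: (hom_factor iBh iBci) => [|x]; last by apply/iBE; apply: ImD.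
  exact: hom_comp (hom_comp (hom_comp iPh th) (gring_act_hom D (a k)))
    (gring_act_hom D (p (idx k))).
(* Although b_k e = b_k, the action of D e is applied as well, so that [fN_e] places the image in
   the kernel of [nm]. *)
have psi_ex k : exists h : B (idx k) -> P, forall y,
    iP (h y) = f (gring_act rho D e (gring_act rho D (b k) (iB y))).
  have [iBh _ _] := B_sub (idx k).
  pose g (y : B (idx k)) := f (gring_act rho D e (gring_act rho D (b k) (iB y))).
  have gh : homomorphism g.
    exact: hom_comp (hom_comp (hom_comp iBh (gring_act_hom D (b k)))
      (gring_act_hom D e)) fh.
  have [|h _ hE] := hom_factor iPh iPci gh; last by exists h.
  move=> y; apply/iPcomp; apply: (image_connected_component gh) => y'.
  by rewrite nmf fN_e.
pose phi k : P -> B (idx k) := s2val (cid2 (phi_ex k)).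
have phi_hom k : homomorphism (phi k) := s2valP (cid2 (phi_ex k)).
have phiE k x : iB (phi k x) = gring_act rho D (p (idx k)) (gring_act rho D (a k) (t (iP x))).
  exact: (s2valP' (cid2 (phi_ex k))).
have Re := mean_diff_ring; have Rp i : (p i \in R_G)%MS := p_group_ring p_idem i.
have RM := subgroup_mean_ring M.
(* The factors come, in this order, from b_k, e, the sum over M that is t f, a_j and p. *)
pose n := (D * D * #|M| * D * D)%N.
have n0 : (0 < n)%N by rewrite !muln_gt0 D0 cardG_gt0.
have phi_psi j k y x : iP x = f (gring_act rho D e (gring_act rho D (b k) (iB y))) ->
    iB (phi j x) = gring_act rho n (b k *m a j *m p (idx j)) (iB (y : B (idx k))).
  move=> xE; have [Ra ea _] := aP j; have [Rb be _] := bP k.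
  rewrite phiE xE tf -gring_act_mean.
  have Ibe := integral_multipleM Re (Db k) De.
  have IbM := integral_multipleM RM Ibe (integral_mean M).
  have Iba := integral_multipleM Ra IbM (Da j).
  rewrite (gring_actM rhoD rhoM _ Re (Db k) De).
  rewrite (gring_actM rhoD rhoM _ RM Ibe (integral_mean M)).
  rewrite (gring_actM rhoD rhoM _ Ra IbM (Da j)).
  rewrite (gring_actM rhoD rhoM _ (Rp _) Iba (Dp _)).
  congr (gring_act _ _ (_ *m _) _).
  by rewrite be -[in LHS]be -(mulmxA (b k)) mean_diff_mean be.
have phi_surj k (y : B (idx k)) :
    exists2 x, phi k x = y & forall j, j != k -> phi j x = 0.
  have [y' y'E] := divisible (char0 n0) y; have [h hE] := psi_ex k; exists (h y').
    have [iBh [_ iB_inj _] iBE] := B_sub (idx k); apply: iB_inj.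
    rewrite (phi_psi _ _ _ _ (hE _)) ba primitive_idem // gring_act_natmul //.
    rewrite ImDE; last by apply/iBE; exists y'.
    by rewrite -y'E (homMn _ _ iBh) -mulrnA mulnC.
  move=> j jk; have [iBh [_ iB_inj _] _] := B_sub (idx j); apply: iB_inj.
  by rewrite (phi_psi _ _ _ _ (hE _)) orth 1?eq_sym // mul0mx gring_act0 (hom0 iBh).
(* By [e_t], D^3 t x is the sum of the actions of D^3 a_k b_k. Writing a_k = a_k p distributes D^3
   over a_k, p and b_k, and the first two give phi_k x = 0. The factor |M| comes from f t. *)
have phi_ker x : (forall k, phi k x = 0) -> x *+ (D * D * D * #|M|) = 0.
  move=> x0; apply: iP_inj; rewrite (hom0 iPh) (homMn _ _ iPh).
  suff tx : t (iP x) *+ (D * D * D) = 0.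
    by rewrite mulnC mulrnA -ft -(homMn _ _ fh) tx (hom0 fh).
  have := e_t _ (nmP x); rewrite mulnC mulrnA => <-; rewrite -gring_act_natmul // -sum_ab.
  rewrite gring_act_sum => [|k]; last first.
    rewrite -mulnA; apply: integral_multiple_dvd (dvdn_mull _ _) _.
      exact: (dvdnn (D * D)).
    by apply: integral_multipleM; have [] := bP k.
  rewrite big1 // => k _; have [Ra _ ap] := aP k; have [Rb _ _] := bP k.
  have [iBh _ _] := B_sub (idx k).
  have Iap := integral_multipleM (Rp (idx k)) (Da k) (Dp (idx k)).
  have := phiE k x; rewrite x0 (hom0 iBh) (gring_actM rhoD rhoM) // ap => E.
  rewrite ap in Iap; rewrite -(gring_actM rhoD rhoM) // -E.
  exact: (hom0 (gring_act_hom _ _)).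
have [r [lu lr] lE] := sort_by_value idx
  (filter_uniq (fun i => i != [1 sG]%irr) (enum_uniq sG)).
exists (fun i => count_mem i [seq idx k | k <- enum 'I_L]).
rewrite -lE; have [Phi [Phih Phi0 Phi_surj]] := hom_to_product phi_hom phi_surj lu.
exists Phi; split=> // [y|]; first by have [x] := Phi_surj y; exists x.
have m0 : (0 < D * D * D * #|M|)%N by rewrite !muln_gt0 D0 cardG_gt0.
have [s sP] := torsion_finite P (char0 m0); exists s => x /Phi0 x0.
apply: sP; apply: phi_ker => k; apply: x0; apply: lr.
by rewrite mem_filter idx1 mem_enum.
Qed.

End PrymIsogeny.

From mathcomp Require Import reals complex.

Theorem proposition3p7 (R : realType)
    (X : variety R[i]) (X_curve : is_curve X)
    (g : nat) (X_genus : has_genus X g) (g_ge2 : (2 <= g)%N)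
    (gT : finGroupType) (to : {action gT &-> X})
    (to_aut : acts_by_automorphisms to)
    (Y : variety R[i]) (Y_curve : is_curve Y)
    (pi : X -> Y) (pi_quo : is_quotient to [set: gT] pi)
    (M N : {group gT}) (sMN : M \subset N)
    (XM XN : variety R[i]) (XM_curve : is_curve XM) (XN_curve : is_curve XN)
    (piM : X -> XM) (piM_quo : is_quotient to M piM)
    (piN : X -> XN) (piN_quo : is_quotient to N piN)
    (psi : XM -> XN) (psi_reg : regular psi)
    (psi_def : forall x, psi (piM x) = piN x)
    (JX JXM JXN : abelian_variety R[i])
    (u : X -> JX) (JX_jac : is_jacobian u)
    (uM : XM -> JXM) (JXM_jac : is_jacobian uM)
    (uN : XN -> JXN) (JXN_jac : is_jacobian uN)
    (rho : gT -> JX -> JX)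
    (rho_def : forall h, is_norm_map (fun x => to x h) u u (rho h))
    (nm : JXM -> JXN) (nm_def : is_norm_map psi uM uN nm)
    (P : abelian_variety R[i]) (iP : P -> JXM) (P_prym : is_prym nm iP)
    (sG : irrType rat [set: gT]%G)
    (p : sG -> 'M[rat]_#|[set: gT]%G|)
    (p_idem : forall i, is_primitive_idempotent i (p i))
    (B : sG -> abelian_variety R[i]) (iB : forall i, B i -> JX)
    (ImP : sG -> JX -> Prop)
    (ImP_def : forall i, is_gring_image rho (p i) (ImP i))
    (B_sub : forall i, abelian_subvariety (iB i) (ImP i)) :
  exists s : sG -> nat,
    isogenous P
      (big_prod_ab
         (flatten [seq nseq (s i) (B i) | i <- enum sG & i != [1 sG]%irr])).
Proof.
apply: (prym_isogenous_product _ to_aut sMN piM_quo piN_quo psi_def JX_jac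
  JXM_jac JXN_jac rho_def nm_def P_prym p_idem ImP_def B_sub).
by move=> n n_gt0; rewrite Num.Theory.pnatr_eq0 -lt0n.
Qed.
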